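(* The lattice of coideal subalgebras of the Kac-Paljutkin algebra $KP$ (dimension $8$) is the following: besides $\mathbb{C}$ and $KP$, there are exactly three coideal subalgebras of dimension $2$, denoted $I_0,I_1,I_2$, and exactly three coideal subalgebras of dimension $4$, denoted $J_0,J_2,J_4$, and no others; the inclusions between distinct ones among these six are exactly $I_0\subset J_0$, $I_1\subset J_0$, $I_2\subset J_0$, $I_0\subset J_2$ and $I_0\subset J_4$.
   Context: A finite-dimensional Kac algebra is a finite-dimensional $C^*$-algebra $K$ with a Hopf algebra structure $(\Delta,\varepsilon,S)$ for which $\Delta$ is a $*$-homomorphism. The Kac-Paljutkin algebra $KP$ is the unique (up to isomorphism) Kac algebra of dimension $8$ that is neither commutative nor cocommutative; as a $C^*$-algebra it is $\mathbb{C}^4\oplus M_2(\mathbb{C})$. A coideal subalgebra of $K$ is a unital $*$-subalgebra $I$ with $\Delta(I)\subset K\otimes I$. *)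

(* Defs.v *)
From HB Require Import structures.
From mathcomp Require Import all_boot all_order all_algebra all_field.
From mathcomp Require Import reals.
From mathcomp Require Export complex.

Set Implicit Arguments.
Unset Strict Implicit.
Unset Printing Implicit Defensive.
Import Order.TTheory GRing.Theory Num.Theory.
Local Open Scope ring_scope.

(* The tensor product of two finite-dimensional spaces, modelled as the space
   of coordinate matrices with respect to their standard bases [vbasis {:V}]
   and [vbasis {:W}].  [tensor] is the universal bilinear map (it is bilinear,
   see [tensor_linearl], [tensor_linearr]), and [tens_lift f] is the linear map
   induced by a bilinear [f] (see [tens_lift_linear], [tens_lift_tensor]).
   The matrix product plays no role. *)
Section Tensor.
Variable F : fieldType.

Definition tens (V W : vectType F) := 'M[F]_(\dim {:V}, \dim {:W}).
HB.instance Definition _ (V W : vectType F) :=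
  Vector.copy (tens V W) 'M[F]_(\dim {:V}, \dim {:W}).

Definition tensor (V W : vectType F) (x : V) (y : W) : tens V W :=
  \matrix_(i, j) (coord (vbasis {:V}) i x * coord (vbasis {:W}) j y).

Definition tens_lift (V W U : vectType F) (f : V -> W -> U) (t : tens V W) : U :=
  \sum_i \sum_j (t : 'M_(_, _)) i j *: f (vbasis {:V})`_i (vbasis {:W})`_j.

Definition tens_flip (V W : vectType F) (t : tens V W) : tens W V :=
  tens_lift (fun x y => tensor y x) t.

Definition tens_map (V W V' W' : vectType F) (f : V -> V') (g : W -> W')
    (t : tens V W) : tens V' W' :=
  tens_lift (fun x y => tensor (f x) (g y)) t.

(* The canonical identification of [(U (x) V) (x) W] with [U (x) (V (x) W)]. *)
Definition tens_assoc (U V W : vectType F) (t : tens (tens U V) W) :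
    tens U (tens V W) :=
  tens_lift (fun s z => tens_lift (fun x y => tensor x (tensor y z)) s) t.

(* The linear span of the [tensor x y] with [x] in [A] and [y] in [B]. *)
Definition tensv (V W : vectType F) (A : {vspace V}) (B : {vspace W}) :
    {vspace tens V W} :=
  <<[seq tensor x y | x <- vbasis A, y <- vbasis B]>>%VS.

(* The product of [A (x) B]: (x (x) y)(x' (x) y') = xx' (x) yy'. *)
Definition tens_mul (A B : falgType F) (s t : tens A B) : tens A B :=
  tens_lift (fun x y => tens_lift (fun x' y' => tensor (x * x') (y * y')) t) s.

Lemma tensor_linearl (V W : vectType F) (y : W) :
  linear (fun x : V => tensor x y).
Proof. by move=> a u v; apply/matrixP=> i j; rewrite !mxE linearP mulrDl mulrA. Qed.

Lemma tensor_linearr (V W : vectType F) (x : V) :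
  linear (fun y : W => tensor x y).
Proof.
by move=> a u v; apply/matrixP=> i j; rewrite !mxE linearP mulrDr mulrCA.
Qed.

Lemma tens_lift_linear (V W U : vectType F) (f : V -> W -> U) :
  linear (tens_lift f).
Proof.
move=> a s t; rewrite /tens_lift scaler_sumr -big_split; apply: eq_bigr => i _.
rewrite scaler_sumr -big_split; apply: eq_bigr => j _ /=.
by rewrite !mxE scalerDl scalerA.
Qed.

Lemma tens_lift_tensor (V W U : vectType F) (f : V -> W -> U) :
    (forall y, linear (fun x => f x y)) -> (forall x, linear (f x)) ->
  forall x y, tens_lift f (tensor x y) = f x y.
Proof.
move=> fl fr x y.
have suml (I : finType) (c : I -> F) (v : I -> V) z :
    f (\sum_i c i *: v i) z = \sum_i c i *: f (v i) z.
  pose L := GRing.isLinear.Build _ _ _ _ (fun x => f x z) (fl z).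
  pose g : {linear V -> U} := HB.pack (fun x => f x z) L.
  rewrite -[LHS]/(g _) linear_sum; apply: eq_bigr => i _.
  by rewrite linearZ.
have sumr (I : finType) (c : I -> F) (v : I -> W) z :
    f z (\sum_i c i *: v i) = \sum_i c i *: f z (v i).
  pose L := GRing.isLinear.Build _ _ _ _ (f z) (fr z).
  pose g : {linear W -> U} := HB.pack (f z) L.
  rewrite -[LHS]/(g _) linear_sum; apply: eq_bigr => i _.
  by rewrite linearZ.
rewrite {2}(coord_vbasis (memvf x)) suml; apply: eq_bigr => i _.
rewrite {2}(coord_vbasis (memvf y)) sumr scaler_sumr; apply: eq_bigr => j _.
by rewrite mxE scalerA.
Qed.

Lemma tens_flip_tensor (V W : vectType F) (x : V) (y : W) :
  tens_flip (tensor x y) = tensor y x.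
Proof.
by apply: (@tens_lift_tensor _ _ _ (fun x y => tensor y x));
  [exact: tensor_linearr | exact: tensor_linearl].
Qed.

Lemma memv_tensor (V W : vectType F) (A : {vspace V}) (B : {vspace W}) x y :
  x \in A -> y \in B -> tensor x y \in tensv A B.
Proof.
move=> /coord_vbasis-> /coord_vbasis->.
set u := \sum_(i < _) _; rewrite memvE.
have lin (U1 U2 : vectType F) (g : U1 -> U2) (gl : linear g)
    (I : finType) (c : I -> F) (v : I -> U1) :
    g (\sum_i c i *: v i) = \sum_i c i *: g (v i).
  pose L := GRing.isLinear.Build _ _ _ _ g gl.
  pose h : {linear U1 -> U2} := HB.pack g L.
  rewrite -[LHS]/(h _) linear_sum; apply: eq_bigr => i _.
  by rewrite linearZ.
rewrite -memvE (lin _ _ _ (@tensor_linearr _ _ u)).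
apply: memv_suml => j _; apply: memvZ; rewrite /u.
rewrite (lin _ _ _ (@tensor_linearl _ _ (vbasis B)`_j)).
apply: memv_suml => i _; apply: memvZ; apply: memv_span.
by apply: allpairs_f; apply: mem_nth; rewrite size_tuple.
Qed.

End Tensor.

Section KacAlgebras.
Variable R : realType.
Local Notation C := (R[i]).

(* The involution of [A (x) B]: (x (x) y)^* = x^* (x) y^*, extended
   antilinearly. *)
Definition tens_star (A B : vectType C) (sA : A -> A) (sB : B -> B)
    (t : tens A B) : tens A B :=
  \sum_i \sum_j ((t : 'M_(_, _)) i j)^* *:
    tensor (sA (vbasis {:A})`_i) (sB (vbasis {:B})`_j).

Definition is_involution (K : falgType C) (star : K -> K) : Prop :=
  [/\ forall x y, star (x + y) = star x + star y,
      forall (a : C) x, star (a *: x) = a^* *: star x,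
      forall x y, star (x * y) = star y * star x
    & forall x, star (star x) = x].

(* Completeness is automatic since [K] is finite-dimensional. *)
Definition is_Cstar_norm (K : falgType C) (star : K -> K) (nm : K -> R) : Prop :=
  [/\ forall x, nm x = 0 -> x = 0,
      forall x y, nm (x + y) <= nm x + nm y,
      forall (a : C) x, nm (a *: x) = ComplexField.Normc.normc a * nm x,
      forall x y, nm (x * y) <= nm x * nm y
    & forall x, nm (star x * x) = nm x ^+ 2].

Definition is_Hopf (K : falgType C) (Delta : {linear K -> tens K K})
    (eps : {linear K -> C^o}) (S : {linear K -> K}) : Prop :=
  [/\ [/\ Delta 1 = tensor 1 1,
          forall x y, Delta (x * y) = tens_mul (Delta x) (Delta y),
          eps 1 = 1
        & forall x y, eps (x * y) = eps x * eps y],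
      (* (Delta (x) id) Delta = (id (x) Delta) Delta *)
      forall x, tens_assoc (tens_map Delta id (Delta x)) =
                tens_map id Delta (Delta x),
      (* (eps (x) id) Delta = id = (id (x) eps) Delta *)
      forall x, tens_lift (fun y z => eps y *: z) (Delta x) = x /\
                tens_lift (fun y z => eps z *: y) (Delta x) = x
    & (* m (S (x) id) Delta = eps 1 = m (id (x) S) Delta *)
      forall x, tens_lift (fun y z => S y * z) (Delta x) = (eps x)%:A /\
                tens_lift (fun y z => y * S z) (Delta x) = (eps x)%:A].

Record kacAlgebra := KacAlgebra {
  kac_sort :> falgType C;
  kstar : kac_sort -> kac_sort;
  knorm : kac_sort -> R;
  kDelta : {linear kac_sort -> tens kac_sort kac_sort};
  keps : {linear kac_sort -> C^o};
  kS : {linear kac_sort -> kac_sort};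
  kstarP : is_involution kstar;
  knormP : is_Cstar_norm kstar knorm;
  kHopfP : is_Hopf kDelta keps kS;
  kDelta_star : forall x, kDelta (kstar x) = tens_star kstar kstar (kDelta x)
}.

(* Such a map automatically preserves the counit, the antipode and the
   C*-norm. *)
Definition kac_isomorphic (K L : kacAlgebra) : Prop :=
  exists f : {linear K -> L},
    [/\ bijective f,
        f 1 = 1 /\ (forall x y, f (x * y) = f x * f y),
        forall x, f (kstar x) = kstar (f x)
      & forall x, kDelta L (f x) = tens_map f f (kDelta K x)].

Definition kac_commutative (K : kacAlgebra) : Prop :=
  forall x y : K, x * y = y * x.

Definition kac_cocommutative (K : kacAlgebra) : Prop :=
  forall x : K, tens_flip (kDelta K x) = kDelta K x.

Definition nontrivial_kac8 (K : kacAlgebra) : Prop :=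
  [/\ \dim {:K} = 8%N, ~ kac_commutative K & ~ kac_cocommutative K].

(* "K is the unique, up to isomorphism, Kac algebra of dimension 8 that is
   neither commutative nor cocommutative." *)
Definition is_Kac_Paljutkin (K : kacAlgebra) : Prop :=
  nontrivial_kac8 K /\
  forall L : kacAlgebra, nontrivial_kac8 L -> kac_isomorphic K L.

Definition coideal_subalgebra (K : kacAlgebra) (I : {vspace K}) : Prop :=
  [/\ 1 \in I,
      forall x y, x \in I -> y \in I -> x * y \in I,
      forall x, x \in I -> kstar x \in I
    & forall x, x \in I -> kDelta K x \in tensv fullv I].

End KacAlgebras.

(* Main.v *)
Require Import Defs.
From HB Require Import structures.
From mathcomp Require Import all_boot all_order all_algebra all_field.
From mathcomp Require Import boolp classical_sets reals ring lra.

(** The hypothesis on [KP] says that every Kac algebra of dimension 8 that is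
    neither commutative nor cocommutative is isomorphic to [KP]. It is thus
    enough to exhibit one such algebra, to compute the lattice of its coideal
    subalgebras, and to carry the answer over along an isomorphism
    ([coideal_img], [kac_isomorphicP]).

    The model [kp_kac] is a crossed product. Let A be the algebra of functions
    on the group G = Z/2 x Z/2, let sigma exchange the two coordinates of G, and
    put omega(s, t) = (-1)^(s t). The algebra is A + A z with z a = sigma(a) z
    and z^2 = omega. The coproduct of A is dual to the addition of G, and
    Delta(z) = J (z tensor z) for the bicharacter J((s, t), (s', t')) =
    (-1)^(t s'). In the coordinates given by the point masses of G times 1 or z
    all structure constants are 0, 1 or -1, so that each axiom is a polynomial
    identity to be checked coordinate by coordinate; elements of a tensor
    product are compared through the products of coordinate functionals
    ([tens_pair_inj]). The C*-norm is the operator norm of left multiplication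
    for the inner product that makes the coordinates orthonormal: left
    multiplication by a^* is adjoint to left multiplication by a
    ([kp_ip_adj]), which gives the C*-identity.

    Let x = (-1)^s and y = (-1)^t in A; they are grouplike. A subspace I with
    Delta(I) included in K tensor I is stable under the slices
    (phi tensor id) Delta. Suitable phi show that with an element

      w = a0 + a1 x + a2 y + a3 xy + (b z + c yz) + (d xz + f xyz)

    I contains each a_i times its grouplike, as well as b z + c yz, d xz + f xyz
    and b xz - c xyz ([kp_mem_gl], [kp_mem_qz]). Hence I is known once one knows
    which grouplikes and which elements b z + c yz it contains. If I contains a
    nonzero q = b z + c yz together with x or y, then multiplying q by x or y on
    either side and slicing produces z and yz, and I is everything ([kp_full_x],
    [kp_full_y]). If I contains such a q but neither x nor y, the coefficient
    (b^2 + c^2) / 2 of x in q^2 vanishes, so c = e b with e^2 = -1; the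
    coefficient of xy in q^2 is then nonzero, and I is the four-dimensional
    span of 1, xy, z + e yz and xz - e xyz ([kp_J_eq]). If I contains no such q,
    it is spanned by a subgroup of {1, x, y, xy}. The proper cases are therefore
    I_0 = <1, xy>, I_1 = <1, x>, I_2 = <1, y>, J_0 = <1, x, y, xy> and the two
    algebras attached to the square roots of -1, for J_2 and J_4; the
    inclusions can be read off from which of five test elements each of them
    contains ([kp_traceE]). *)

Set Implicit Arguments.
Unset Strict Implicit.
Unset Printing Implicit Defensive.
Import Order.TTheory GRing.Theory Num.Theory.
Local Open Scope ring_scope.

(** * Tensor products *)

Section TensorTheory.
Variable F : fieldType.
Implicit Types V W U : vectType F.

HB.instance Definition _ V W U (f : V -> W -> U) :=
  GRing.isLinear.Build F (tens V W) U _ (tens_lift f) (tens_lift_linear f).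

HB.instance Definition _ V W (x : V) :=
  GRing.isLinear.Build F W (tens V W) _ (tensor x) (tensor_linearr x).

Lemma tensorDl V W (x x' : V) (y : W) :
  tensor (x + x') y = tensor x y + tensor x' y.
Proof. by have:= tensor_linearl y 1 x x'; rewrite !scale1r. Qed.

Lemma tensorZl V W a (x : V) (y : W) : tensor (a *: x) y = a *: tensor x y.
Proof.
have:= tensor_linearl y a x 0; rewrite addr0 => ->; apply/matrixP=> i j.
by rewrite !mxE linear0 mul0r addr0.
Qed.

Lemma tens_coordE V W (t : tens V W) :
  t = \sum_i \sum_j (t : 'M_(_, _)) i j *:
        tensor (vbasis {:V})`_i (vbasis {:W})`_j.
Proof.
apply/matrixP=> a b; rewrite summxE (bigD1 a) //= summxE (bigD1 b) //=.
have cE (X : vectType F) (i j : 'I_(\dim {:X})) :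
    coord (vbasis {:X}) i (vbasis {:X})`_j = (j == i)%:R.
  exact: coord_free (basis_free (vbasisP _)).
have ZE c (u : tens V W) i j : ((c *: u : tens V W) : 'M_(_, _)) i j
  = c * (u : 'M_(_, _)) i j by apply: mxE.
rewrite !ZE mxE !cE !eqxx !mulr1 !big1 ?addr0 // => [i ia|j jb].
  by rewrite summxE big1 // => j _; rewrite ZE mxE !cE (negPf ia) mul0r mulr0.
by rewrite ZE mxE !cE (negPf jb) !mulr0.
Qed.

Lemma tens_lift_id V W (t : tens V W) : tens_lift (@tensor F V W) t = t.
Proof. by rewrite {2}(tens_coordE t). Qed.

Lemma eq_tens_lift V W U (f g : V -> W -> U) :
  f =2 g -> tens_lift f =1 tens_lift g.
Proof. by move=> fg t; apply: eq_bigr => i _; apply: eq_bigr => j _; rewrite fg. Qed.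

Lemma linear_tens_lift V W U U' (h : {linear U -> U'}) (f : V -> W -> U) t :
  h (tens_lift f t) = tens_lift (fun x y => h (f x y)) t.
Proof.
rewrite linear_sum; apply: eq_bigr => i _; rewrite linear_sum.
by apply: eq_bigr => j _; rewrite linearZ.
Qed.

(** The functional phi tensor psi. *)
Definition tens_pair V W (phi : V -> F) (psi : W -> F) : tens V W -> F :=
  tens_lift (fun x y => (phi x * psi y : F^o)).
Arguments tens_pair : simpl never.
HB.instance Definition _ V W (phi : V -> F) (psi : W -> F) :=
  GRing.isLinear.Build F (tens V W) F^o _ (tens_pair phi psi)
    (tens_lift_linear (fun x y => (phi x * psi y : F^o))).

Lemma tens_pair_tensor V W (phi : {linear V -> F^o}) (psi : {linear W -> F^o}) x y :
  tens_pair phi psi (tensor x y) = phi x * psi y.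
Proof.
apply: (@tens_lift_tensor _ _ _ _ (fun x y => (phi x * psi y : F^o))).
  by move=> z a u v; rewrite linearP mulrDl scalerAl.
by move=> z a u v; rewrite linearP mulrDr scalerAr.
Qed.

(** The slice map phi tensor id. *)
Definition slice V W (phi : V -> F) : tens V W -> W :=
  tens_lift (fun x y => phi x *: y).
Arguments slice : simpl never.
HB.instance Definition _ V W (phi : V -> F) :=
  GRing.isLinear.Build F (tens V W) W _ (slice phi)
    (tens_lift_linear (fun x y => phi x *: y)).

Lemma slice_tensor V W (phi : {linear V -> F^o}) x (y : W) :
  slice phi (tensor x y) = phi x *: y.
Proof.
apply: (@tens_lift_tensor _ _ _ _ (fun x (y : W) => phi x *: y)) => z a u v.
  by rewrite linearP scalerDl scalerA.
by rewrite scalerDr !scalerA mulrC.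
Qed.

(** This is how a coideal is used: slicing the coproduct of an element of a
    coideal gives elements of the coideal. *)
Lemma slice_tensv V W (A : {vspace V}) (I : {vspace W}) (phi : {linear V -> F^o}) t :
  t \in tensv A I -> slice phi t \in I.
Proof.
rewrite /tensv; set s := [seq _ | _ <- _, _ <- _] => ts.
rewrite (@coord_span _ _ _ (in_tuple s) t ts) linear_sum memv_suml // => i _.
rewrite linearZ memvZ //.
have/allpairsP[[u v] [/= _ vI ->]]: s`_i \in s by rewrite mem_nth.
by rewrite slice_tensor memvZ // vbasis_mem.
Qed.

(** If phi and psi separate the points of V and W, then the functionals
    phi_i tensor psi_j separate the points of V tensor W: apply psi_j to the rows
    of the coordinate matrix first, then phi_i to the resulting vectors. *)
Lemma tens_pair_inj V W (I J : Type) (phi : I -> {linear V -> F^o})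
    (psi : J -> {linear W -> F^o}) :
    (forall x, (forall i, phi i x = 0) -> x = 0) ->
    (forall y, (forall j, psi j y = 0) -> y = 0) ->
  forall s t : tens V W, (forall i j, tens_pair (phi i) (psi j) s =
     tens_pair (phi i) (psi j) t) -> s = t.
Proof.
move=> phi0 psi0 s t st; apply/subr0_eq; set d := s - t.
have{st} d0 i j : tens_pair (phi i) (psi j) d = 0.
  by rewrite raddfB /= st subrr.
have free_coef (X : vectType F) (c : 'I_(\dim {:X}) -> F) :
    \sum_i c i *: (vbasis {:X})`_i = 0 -> forall i, c i = 0.
  by move/freeP: (basis_free (vbasisP {:X})); apply.
pose r a : W := \sum_b (d : 'M_(_, _)) a b *: (vbasis {:W})`_b.
suff r0 a : r a = 0.
  by apply/matrixP=> a b; rewrite [LHS](free_coef W _ (r0 a) b) mxE.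
apply: psi0 => j; move: a; apply: (free_coef V) => //; apply: phi0 => i.
rewrite -[RHS](d0 i j) linear_sum; apply: eq_bigr => a _.
rewrite linearZ /= linear_sum scaler_suml; apply: eq_bigr => b _.
by rewrite linearZ -scalerA [psi j _ *: _]mulrC.
Qed.

HB.instance Definition _ V W V' W' (f : V -> V') (g : W -> W') :=
  GRing.isLinear.Build F (tens V W) (tens V' W') _ (tens_map f g)
    (tens_lift_linear (fun x y => tensor (f x) (g y))).

Lemma tens_map_tensor V W V' W' (f : {linear V -> V'}) (g : {linear W -> W'}) x y :
  tens_map f g (tensor x y) = tensor (f x) (g y).
Proof.
apply: (@tens_lift_tensor _ _ _ _ (fun x y => tensor (f x) (g y))) => z a u v.
  by rewrite linearP tensorDl tensorZl.
by rewrite linearP linearP.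
Qed.

Lemma tens_mapK V W V' W' (f : V -> V') (f' : W -> W')
    (g : {linear V' -> V}) (g' : {linear W' -> W}) :
  cancel f g -> cancel f' g' -> cancel (tens_map f f') (tens_map g g').
Proof.
move=> fK fK' t; rewrite linear_tens_lift -[RHS]tens_lift_id.
by apply: eq_tens_lift => x y /=; rewrite tens_map_tensor fK fK'.
Qed.

Lemma eq_tens_pair V W (phi phi' : V -> F) (psi psi' : W -> F) :
  phi =1 phi' -> psi =1 psi' -> tens_pair phi psi =1 tens_pair phi' psi'.
Proof. by move=> ep es t; apply: (@eq_tens_lift _ _ F^o) => x y; rewrite ep es. Qed.

Lemma tens_pairZl V W a (phi : V -> F) (psi : W -> F) t :
  tens_pair (fun x => a * phi x) psi t = a * tens_pair phi psi t.
Proof.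
rewrite /tens_pair [RHS](linear_tens_lift (a \*: (idfun : F^o -> F^o))).
by apply: (@eq_tens_lift _ _ F^o) => x y; rewrite /= /GRing.scale /= mulrA.
Qed.

Lemma tens_pairZr V W a (phi : V -> F) (psi : W -> F) t :
  tens_pair phi (fun x => a * psi x) t = a * tens_pair phi psi t.
Proof.
rewrite -tens_pairZl; apply: (@eq_tens_lift _ _ F^o) => x y.
by rewrite mulrCA mulrA.
Qed.

Lemma tens_liftD V W U (f g : V -> W -> U) t :
  tens_lift (fun x y => f x y + g x y) t = tens_lift f t + tens_lift g t.
Proof.
rewrite -big_split; apply: eq_bigr => i _; rewrite -big_split.
by apply: eq_bigr => j _; rewrite scalerDr.
Qed.

Lemma tens_pair_map V W V' W' (f : V -> V') (g : W -> W')
    (phi : {linear V' -> F^o}) (psi : {linear W' -> F^o}) t :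
  tens_pair phi psi (tens_map f g t) =
  tens_pair (fun x => phi (f x)) (fun y => psi (g y)) t.
Proof.
rewrite [LHS]linear_tens_lift; apply: (@eq_tens_lift _ _ F^o) => x y.
exact: tens_pair_tensor.
Qed.

Lemma tens_pair_flip V W (phi : {linear W -> F^o}) (psi : {linear V -> F^o})
    (t : tens V W) :
  tens_pair phi psi (tens_flip t) = tens_pair psi phi t.
Proof.
rewrite [LHS]linear_tens_lift; apply: (@eq_tens_lift _ _ F^o) => x y.
by rewrite [LHS]tens_pair_tensor mulrC.
Qed.

Lemma tens_pair_assoc U V W (phi : {linear U -> F^o}) (psi : {linear V -> F^o})
    (chi : {linear W -> F^o}) t :
  tens_pair phi (tens_pair psi chi) (tens_assoc t) =
  tens_pair (tens_pair phi psi) chi t.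
Proof.
rewrite [LHS]linear_tens_lift; apply: (@eq_tens_lift _ _ F^o) => s z /=.
rewrite linear_tens_lift -[tens_pair phi psi s * _]mulrC.
rewrite [in RHS]/tens_pair [RHS](linear_tens_lift (chi z \*: (idfun : F^o -> F^o))).
apply: (@eq_tens_lift _ _ F^o) => x y /=.
rewrite [LHS](@tens_pair_tensor _ _ phi (tens_pair psi chi)) /=.
rewrite tens_pair_tensor.
by rewrite /GRing.scale /= mulrA mulrC.
Qed.

(** The two-term shape of the hypotheses is that of the coordinates of a
    product in an algebra A + A z, where such a coordinate has one contribution
    from A and one from A z in the left factor. *)
Lemma tens_pair_mul (A B : falgType F) (phi : {linear A -> F^o})
    (psi : {linear B -> F^o}) (phi1 phi2 phi3 phi4 : A -> F)
    (psi1 psi2 psi3 psi4 : B -> F) :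
    (forall x x', phi (x * x') = phi1 x * phi2 x' + phi3 x * phi4 x') ->
    (forall y y', psi (y * y') = psi1 y * psi2 y' + psi3 y * psi4 y') ->
  forall s t, tens_pair phi psi (tens_mul s t) =
    tens_pair phi1 psi1 s * tens_pair phi2 psi2 t +
    tens_pair phi1 psi3 s * tens_pair phi2 psi4 t +
    tens_pair phi3 psi1 s * tens_pair phi4 psi2 t +
    tens_pair phi3 psi3 s * tens_pair phi4 psi4 t.
Proof.
move=> phiM psiM s t.
have E f g : tens_lift (fun x y => tens_lift (fun x' y' => f x y * g x' y' : F^o) t) s
  = tens_lift (fun x y => f x y : F^o) s * tens_lift (fun x y => g x y : F^o) t.
  rewrite mulrC [RHS](linear_tens_lift
    ((tens_lift (fun x y => g x y : F^o) t : F) \*: (idfun : F^o -> F^o))).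
  apply: (@eq_tens_lift _ _ F^o) => x y /=; rewrite /GRing.scale /= mulrC.
  by rewrite [RHS](linear_tens_lift ((f x y : F) \*: (idfun : F^o -> F^o))).
rewrite -!E [LHS]linear_tens_lift -!big_split; apply: eq_bigr => i _.
rewrite -!big_split; apply: eq_bigr => j _ /=.
rewrite ![in RHS]/GRing.scale /= -!mulrDr; congr (_ * _).
rewrite [LHS]linear_tens_lift -!big_split; apply: eq_bigr => a _.
rewrite -!big_split; apply: eq_bigr => b _ /=.
rewrite ![in RHS]/GRing.scale /= -!mulrDr; congr (_ * _).
by rewrite [LHS]tens_pair_tensor phiM psiM /=; ring.
Qed.
End TensorTheory.

Lemma tens_pair_star (R : realType) (A B : vectType R[i]) (sA : A -> A)
    (sB : B -> B) (phi : {linear A -> R[i]^o}) (psi : {linear B -> R[i]^o})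
    (phi' : A -> R[i]) (psi' : B -> R[i]) :
    (forall x, phi (sA x) = (phi' x)^*) -> (forall y, psi (sB y) = (psi' y)^*) ->
  forall t, tens_pair phi psi (tens_star sA sB t) = (tens_pair phi' psi' t)^*.
Proof.
move=> hphi hpsi t; rewrite linear_sum rmorph_sum; apply: eq_bigr => i _.
rewrite linear_sum rmorph_sum; apply: eq_bigr => j _.
by rewrite linearZ /= tens_pair_tensor hphi hpsi !rmorphM.
Qed.

Lemma tens_map_tensv (F : fieldType) (V V' W W' : vectType F)
    (f : {linear V -> V'}) (g : {linear W -> W'})
    (A : {vspace V}) (B : {vspace W}) t :
  t \in tensv A B ->
  tens_map f g t \in tensv (linfun f @: A) (linfun g @: B).
Proof.
rewrite /tensv; set s := [seq _ | _ <- vbasis A, _ <- _] => ts.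
rewrite (@coord_span _ _ _ (in_tuple s) t ts) linear_sum memv_suml // => i _.
rewrite linearZ memvZ //=.
have/allpairsP[[u v] [/= uA vB ->]]: s`_i \in s by rewrite mem_nth.
rewrite tens_map_tensor; apply: memv_tensor.
  by rewrite -(lfunE f) memv_img // vbasis_mem.
by rewrite -(lfunE g) memv_img // vbasis_mem.
Qed.

Lemma tensv_mono (F : fieldType) (V W : vectType F)
    (A A' : {vspace V}) (B : {vspace W}) : (A <= A')%VS ->
  (tensv A B <= tensv A' B)%VS.
Proof.
move=> sA; apply/span_subvP=> _ /allpairsP[[u v] [/= uA vB ->]].
by apply: memv_tensor; [apply: (subvP sA) | ]; apply: vbasis_mem.
Qed.

(** * The crossed product algebra and its structure maps *)

Ltac kp_cases := case=> [[[] []] []].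
Ltac kp_ext := apply/ffunP; kp_cases; rewrite !ffunE /= ?ffunE /=.

(** The index (s, t, k) stands for the point mass at (s, t) in Z/2 x Z/2,
    multiplied by z when k holds. *)
Definition kp_index : finType := (bool * bool * bool)%type.

Section Model.
Variable R : realType.
Local Notation C := (R[i]).

(** A synonym of the function space, so that it can carry the crossed
    product multiplication instead of the pointwise one. *)
Definition kp_alg := {ffun kp_index -> C^o}.
HB.instance Definition _ := Vector.on kp_alg.
Implicit Types u v w : kp_alg.

Definition sgb (b : bool) : C := if b then -1 else 1.

(** The value of u v at (s, t): the part of v is evaluated at the exchanged
    point (t, s) when it has been moved across z, and two factors z contribute
    omega(s, t) = (-1)^(s t). *)
Definition kp_mul u v : kp_alg := [ffun i : kp_index => let: (s, t, k) := i in
  u (s, t, false) * v (s, t, k) +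
  sgb [&& s, t & ~~ k] * (u (s, t, true) * v (t, s, ~~ k))].
Definition kp_one : kp_alg := [ffun i : kp_index => (~~ i.2)%:R].

Lemma kp_mulA : associative kp_mul.
Proof. by move=> u v w; kp_ext; rewrite /sgb /=; ring. Qed.
Lemma kp_mul1 : left_id kp_one kp_mul.
Proof. by move=> u; kp_ext; rewrite /sgb /=; ring. Qed.
Lemma kp_mulr1 : right_id kp_one kp_mul.
Proof. by move=> u; kp_ext; rewrite /sgb /=; ring. Qed.
Lemma kp_mulDl : left_distributive kp_mul +%R.
Proof. by move=> u v w; kp_ext; rewrite /sgb /=; ring. Qed.
Lemma kp_mulDr : right_distributive kp_mul +%R.
Proof. by move=> u v w; kp_ext; rewrite /sgb /=; ring. Qed.
Lemma kp_one_neq0 : kp_one != 0.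
Proof.
by apply/eqP=> /ffunP/(_ (false, false, false)) /eqP; rewrite !ffunE oner_eq0.
Qed.

HB.instance Definition _ := GRing.Zmodule_isNzRing.Build kp_alg
  kp_mulA kp_mul1 kp_mulr1 kp_mulDl kp_mulDr kp_one_neq0.

Lemma kp_scalerAl (a : C) u v : a *: (u * v) = a *: u * v.
Proof. by kp_ext; rewrite /GRing.scale /=; ring. Qed.
HB.instance Definition _ := GRing.Lmodule_isLalgebra.Build C kp_alg kp_scalerAl.
Lemma kp_scalerAr (a : C) u v : a *: (u * v) = u * (a *: v).
Proof. by kp_ext; rewrite /GRing.scale /=; ring. Qed.
HB.instance Definition _ := GRing.Lalgebra_isAlgebra.Build C kp_alg kp_scalerAr.
HB.instance Definition _ := Algebra_isFalgebra.Build C kp_alg.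

Lemma kp_mulE u v s t k : (u * v) (s, t, k) =
  u (s, t, false) * v (s, t, k) +
  sgb [&& s, t & ~~ k] * (u (s, t, true) * v (t, s, ~~ k)).
Proof. by rewrite ffunE. Qed.

Lemma kp_oneE i : (1 : kp_alg) i = (~~ i.2)%:R.
Proof. by rewrite ffunE. Qed.

Definition kp_star u : kp_alg := [ffun i : kp_index => let: (s, t, k) := i in
  if k then sgb (s && t) * (u (t, s, true))^* else (u (s, t, false))^*].

Definition kp_S u : kp_alg := [ffun i : kp_index => let: (s, t, k) := i in
  if k then u (t, s, true) else u (s, t, false)].

Definition kp_eps u : C^o := u (false, false, false) + u (false, false, true).

(** The bicharacter J on the z-part, the constant 1 on the function part, and
    0 between the two. *)
Definition kp_cocycle (i j : kp_index) : C :=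
  let: (s, t, k) := i in let: (s', t', k') := j in
  if k == k' then sgb [&& k, t & s'] else 0.
(** Addition of Z/2 x Z/2. The last component of the second index is dropped
    since [kp_cocycle] vanishes unless it equals that of the first. *)
Definition kp_dot (i j : kp_index) : kp_index :=
  let: (s, t, k) := i in let: (s', t', k') := j in (s (+) s', t (+) t', k).
Definition kp_coef u (i j : kp_index) : C := kp_cocycle i j * u (kp_dot i j).

Definition kp_e (i : kp_index) : kp_alg := [ffun j => (i == j)%:R].

Definition kp_Delta u : tens kp_alg kp_alg :=
  \sum_i \sum_j kp_coef u i j *: tensor (kp_e i) (kp_e j).

Definition kp_ev (i : kp_index) u : C^o := u i.
Fact kp_ev_linear i : linear (kp_ev i).
Proof. by move=> a u v; rewrite /kp_ev !ffunE. Qed.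
HB.instance Definition _ i := GRing.isLinear.Build C kp_alg C^o _
  (kp_ev i) (kp_ev_linear i).

Fact kp_coef_linear i j : linear (fun u => kp_coef u i j : C^o).
Proof.
by move=> a u v; rewrite /kp_coef !ffunE /GRing.scale /=; ring.
Qed.

Fact kp_Delta_linear : linear kp_Delta.
Proof.
move=> a u v; rewrite /kp_Delta scaler_sumr -big_split; apply: eq_bigr => i _.
rewrite scaler_sumr -big_split; apply: eq_bigr => j _ /=.
by rewrite (kp_coef_linear i j a u v) scalerDl -scalerA.
Qed.
HB.instance Definition _ := GRing.isLinear.Build C kp_alg _ _ kp_Delta kp_Delta_linear.

Fact kp_S_linear : linear kp_S.
Proof. by move=> a u v; kp_ext. Qed.
HB.instance Definition _ := GRing.isLinear.Build C kp_alg _ _ kp_S kp_S_linear.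

Fact kp_eps_linear : linear kp_eps.
Proof. by move=> a u v; rewrite /kp_eps !ffunE /GRing.scale /=; ring. Qed.
HB.instance Definition _ := GRing.isLinear.Build C kp_alg C^o _ kp_eps kp_eps_linear.

Lemma kp_ev_e i j : kp_ev i (kp_e j) = (i == j)%:R.
Proof. by rewrite /kp_ev ffunE eq_sym. Qed.

Lemma kp_Delta_coef u i j :
  tens_pair (kp_ev i) (kp_ev j) (kp_Delta u) = kp_coef u i j.
Proof.
transitivity (\sum_a \sum_b kp_coef u a b * ((i == a)%:R * (j == b)%:R)).
  rewrite [LHS]linear_sum; apply: eq_bigr => a _; rewrite linear_sum.
  apply: eq_bigr => b _; rewrite linearZ /= tens_pair_tensor /=.
  by rewrite !kp_ev_e.
rewrite (bigD1 i) //= (bigD1 j) //= !eqxx !mulr1 !big1 ?addr0 // => [a ai|b bj].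
  by rewrite big1 // => b _; rewrite eq_sym (negPf ai) mul0r mulr0.
by rewrite eq_sym (negPf bj) !mulr0.
Qed.

(** All identities between tensors over the model are proved by comparing
    coordinates. *)
Lemma kp_tens_ext (s t : tens kp_alg kp_alg) :
  (forall i j, tens_pair (kp_ev i) (kp_ev j) s =
               tens_pair (kp_ev i) (kp_ev j) t) -> s = t.
Proof.
by apply: tens_pair_inj => x x0; apply/ffunP=> i; rewrite ffunE; apply: x0.
Qed.
End Model.

(** * Hopf algebra axioms *)

Section Hopf.
Variable R : realType.
Local Notation C := (R[i]).
Local Notation kp := (kp_alg R).
Implicit Types u v w : kp.

Lemma sgb_conj b : (sgb R b)^* = sgb R b.
Proof. by case: b; rewrite /sgb ?rmorphN rmorph1. Qed.

(** The star sends a z to z^* times the conjugate of a, where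
    z^* = omega z is the inverse of z. *)
Lemma kp_starP : is_involution (@kp_star R).
Proof.
split=> [u v|a u|u v|u].
- by kp_ext; rewrite rmorphD ?mulrDr.
- by kp_ext; rewrite /GRing.scale /= rmorphM /= ?mul1r ?mulN1r ?mulrN.
- by kp_ext; rewrite /sgb /= !(rmorphD, rmorphM, rmorphN, rmorph1) /=; ring.
- by kp_ext; rewrite ?rmorphM ?rmorphN ?rmorph1 /= ?conjCK ?mul1r
     ?mulN1r ?mulNr ?opprK ?mul1r.
Qed.

Lemma kp_ev_mul i u v : kp_ev i (u * v) =
  kp_ev (i.1, false) u * kp_ev i v +
  kp_ev (i.1, true) u * (sgb R [&& i.1.1, i.1.2 & ~~ i.2] *
   kp_ev (i.1.2, i.1.1, ~~ i.2) v).
Proof. by case: i => [[s t] k]; rewrite /kp_ev kp_mulE /= mulrCA. Qed.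

Lemma kp_Delta1 : kp_Delta (1 : kp) = tensor 1 1.
Proof.
apply: kp_tens_ext => i j; rewrite kp_Delta_coef tens_pair_tensor /= /kp_coef /kp_ev.
rewrite !kp_oneE; move: i j => [[s t] []] [[s' t'] []];
by rewrite /= ?(mulr0, mul0r, mulr1).
Qed.

(** In coordinates both sides are bilinear forms with at most four terms. The
    identity behind the sign bookkeeping is J(h, h') J(sigma h, sigma h') omega(h + h')
    = omega(h) omega(h'), that is Delta(z)^2 = Delta(z^2). *)
Lemma kp_DeltaM u v : kp_Delta (u * v) = tens_mul (kp_Delta u) (kp_Delta v).
Proof.
apply: kp_tens_ext => i j.
rewrite (tens_pair_mul (kp_ev_mul i) (kp_ev_mul j)).
rewrite !(tens_pairZl, tens_pairZr) !kp_Delta_coef /kp_coef.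
move: i j => [[s t] k] [[s' t'] k'] /=; rewrite kp_mulE.
by move: k k' s t s' t' => [] [] [] [] [] []; rewrite /sgb /=; ring.
Qed.

(** The 2-cocycle identity, which is equivalent to coassociativity. *)
Lemma kp_cocycleP i j k :
  kp_cocycle R i j * kp_cocycle R (kp_dot i j) k =
  kp_cocycle R j k * kp_cocycle R i (kp_dot j k).
Proof.
move: i j k => [[s t] k] [[s' t'] k'] [[s'' t''] k''].
case: k k' k'' => [] [] []; rewrite /= ?(mulr0, mul0r) //.
by case: s s' s'' t t' t'' => [] [] [] [] [] [];
  rewrite /sgb /= ?(mulr1, mul1r, mulrN1, mulN1r, opprK).
Qed.

Lemma kp_tens3_ext (s t : tens kp (tens kp kp)) :
    (forall i j k, tens_pair (kp_ev i) (tens_pair (kp_ev j) (kp_ev k)) s =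
                   tens_pair (kp_ev i) (tens_pair (kp_ev j) (kp_ev k)) t) ->
  s = t.
Proof.
move=> st; pose phi i : {linear kp -> C^o} := @kp_ev R i.
pose psi (p : kp_index * kp_index) : {linear tens kp kp -> C^o} :=
  tens_pair (@kp_ev R p.1) (@kp_ev R p.2).
apply: (@tens_pair_inj _ _ _ _ _ phi psi) => [x x0|y y0|i [j k]].
- by apply/ffunP=> i; rewrite ffunE; apply: x0.
- by apply: kp_tens_ext => i j; rewrite linear0; apply: (y0 (i, j)).
- exact: st.
Qed.

Lemma kp_Delta_coassoc u :
  tens_assoc (tens_map (@kp_Delta R) id (kp_Delta u)) =
  tens_map id (@kp_Delta R) (kp_Delta u).
Proof.
apply: kp_tens3_ext => i j k.
transitivity (kp_cocycle R i j * kp_cocycle R (kp_dot i j) k *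
              kp_ev (kp_dot (kp_dot i j) k) u).
  rewrite tens_pair_assoc tens_pair_map.
  rewrite (eq_tens_pair (phi' := fun v => kp_cocycle R i j * kp_ev (kp_dot i j) v)
    (psi' := kp_ev k)) // => [|v]; last exact: kp_Delta_coef.
  by rewrite tens_pairZl kp_Delta_coef mulrA.
rewrite [RHS]tens_pair_map.
rewrite (eq_tens_pair (phi' := kp_ev i)
  (psi' := fun v => kp_cocycle R j k * kp_ev (kp_dot j k) v)) // => [|v]; last first.
  exact: kp_Delta_coef.
rewrite tens_pairZr kp_Delta_coef mulrA -kp_cocycleP; congr (_ * u _).
by case: i j k => [[s t] ?] [[s' t'] ?] [[s'' t''] ?] /=; rewrite !addbA.
Qed.

Lemma kp_counit u :
  tens_lift (fun v w => kp_eps v *: w) (kp_Delta u) = u /\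
  tens_lift (fun v w => kp_eps w *: v) (kp_Delta u) = u.
Proof.
split; apply/ffunP=> -[[s t] k].
  rewrite -[LHS]/(kp_ev (s, t, k) _) linear_tens_lift.
  rewrite (eq_tens_lift (g := fun v w =>
    (kp_ev (false, false, false) v * kp_ev (s, t, k) w : C^o) +
    kp_ev (false, false, true) v * kp_ev (s, t, k) w)); last first.
    by move=> v w; rewrite linearZ /= -mulrDl.
  rewrite tens_liftD -!/(tens_pair _ _) !kp_Delta_coef /kp_coef.
  by case: k; rewrite /sgb /= ?(mul0r, mul1r, add0r, addr0).
rewrite -[LHS]/(kp_ev (s, t, k) _) linear_tens_lift.
rewrite (eq_tens_lift (g := fun v w =>
  (kp_ev (s, t, k) v * kp_ev (false, false, false) w : C^o) +
  kp_ev (s, t, k) v * kp_ev (false, false, true) w)); last first.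
  by move=> v w; rewrite linearZ /= -mulrDr mulrC.
rewrite tens_liftD -!/(tens_pair _ _) !kp_Delta_coef /kp_coef.
by case: k; rewrite /sgb /= !addbF ?andbF ?(mul0r, mul1r, add0r, addr0).
Qed.

(** On the z-part, the antipode exchanges (s, t) with (t, s) and fixes z; the
    signs cancel because J(h, h) = omega(h). *)
Lemma kp_antipode u :
  tens_lift (fun v w => kp_S v * w) (kp_Delta u) = (kp_eps u)%:A /\
  tens_lift (fun v w => v * kp_S w) (kp_Delta u) = (kp_eps u)%:A.
Proof.
split; apply/ffunP=> -[[s t] k].
  rewrite -[LHS]/(kp_ev (s, t, k) _) linear_tens_lift.
  rewrite (eq_tens_lift (g := fun v w =>
    (kp_ev (s, t, false) v * kp_ev (s, t, k) w : C^o) +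
    kp_ev (t, s, true) v * (sgb R [&& s, t & ~~ k] * kp_ev (t, s, ~~ k) w)));
    last by move=> v w; rewrite [LHS]kp_ev_mul /kp_ev !ffunE /= mulrCA.
  rewrite tens_liftD -!/(tens_pair _ _) tens_pairZr !kp_Delta_coef /kp_coef.
  rewrite /kp_eps !ffunE /GRing.scale /=.
  by case: k s t => [] [] []; rewrite /sgb /=; ring.
rewrite -[LHS]/(kp_ev (s, t, k) _) linear_tens_lift.
rewrite (eq_tens_lift (g := fun v w =>
  (kp_ev (s, t, false) v * (if k then kp_ev (t, s, k) w else kp_ev (s, t, k) w) : C^o) +
  kp_ev (s, t, true) v * (sgb R [&& s, t & ~~ k] *
    (if k then kp_ev (t, s, ~~ k) w else kp_ev (s, t, ~~ k) w))));
  last by move=> v w; rewrite [LHS]kp_ev_mul /kp_ev !ffunE /=; case: k.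
rewrite tens_liftD /kp_eps !ffunE /GRing.scale /=.
case: k; rewrite -!/(tens_pair _ _) tens_pairZr !kp_Delta_coef /kp_coef /=;
by case: s t => [] []; rewrite /sgb /=; ring.
Qed.

Lemma kp_HopfP : is_Hopf (@kp_Delta R) (@kp_eps R) (@kp_S R).
Proof.
split; [split | exact: kp_Delta_coassoc | exact: kp_counit | exact: kp_antipode].
- exact: kp_Delta1.
- exact: kp_DeltaM.
- by rewrite /= /kp_eps !kp_oneE addr0.
- by move=> u v; rewrite /= /kp_eps !kp_mulE /sgb /=; ring.
Qed.

Lemma kp_Delta_star u :
  kp_Delta (kp_star u) = tens_star (@kp_star R) (@kp_star R) (kp_Delta u).
Proof.
pose c (i : kp_index) := if i.2 then sgb R (i.1.1 && i.1.2) else 1.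
(* The star permutes the coordinates up to sign and conjugation. *)
pose d (i : kp_index) : kp_index :=
  if i.2 then (i.1.2, i.1.1, true) else i.
have E i x : kp_ev i (kp_star x) = (c i * kp_ev (d i) x)^*.
  case: i => [[s t] []]; rewrite /kp_ev ffunE /c /d /= ?mul1r //.
  by rewrite rmorphM -[X in X^* * _]/(sgb R _) sgb_conj.
apply: kp_tens_ext => i j; rewrite (tens_pair_star (E i) (E j)).
rewrite !(tens_pairZl, tens_pairZr) !kp_Delta_coef /kp_coef ffunE.
move: i j => [[s t] k] [[s' t'] k']; rewrite /c /d /=.
case: k k' => [] []; rewrite /= !(rmorphM, rmorphN, sgb_conj, rmorph1, rmorph0,
  mulr0, mul0r) //= ?mul1r //.
rewrite !sgb_conj.
by case: s s' t t' => [] [] [] [];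
  rewrite /sgb /= ?(mulr1, mul1r, mulrN1, mulN1r, opprK).
Qed.
End Hopf.

(** * The operator norm *)

Section Norm.
Variable R : realType.
Local Notation C := (R[i]).
Local Notation kp := (kp_alg R).
Local Notation normc := ComplexField.Normc.normc.
Implicit Types u v w x y : kp.

Lemma kp_sum (V : nmodType) (F : kp_index -> V) : \sum_i F i =
  F (true, true, true) + F (true, true, false) + F (true, false, true) +
  F (true, false, false) + F (false, true, true) + F (false, true, false) +
  F (false, false, true) + F (false, false, false).
Proof.
rewrite (eq_bigr (fun i : kp_index => F (i.1, i.2))) => [|[]] //.
rewrite -(pair_bigA _ (fun i j => F (i, j))) /=.
under eq_bigr do rewrite big_bool.
rewrite (eq_bigr (fun i : bool * bool =>
  F ((i.1, i.2), true) + F ((i.1, i.2), false))) => [|[]] //.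
rewrite -(pair_bigA _ (fun i j => F (i, j, true) + F (i, j, false))) /=.
by rewrite !big_bool /= !addrA.
Qed.

Definition kp_ip u v : C := \sum_i u i * (v i)^*.
(** The real part is all that the norm estimates need, and it gives
    inequalities in [R]. *)
Definition kp_rip u v : R := complex.Re (kp_ip u v).
Definition kp_hn u : R := Num.sqrt (kp_rip u u).

Lemma complex_ReD (a b : C) : complex.Re (a + b) = complex.Re a + complex.Re b.
Proof. by case: a; case: b. Qed.

Lemma kp_ipC u v : kp_ip v u = (kp_ip u v)^*.
Proof.
rewrite rmorph_sum; apply: eq_bigr => i _.
by rewrite rmorphM /= conjCK mulrC.
Qed.

Lemma kp_ipDl u v w : kp_ip (u + v) w = kp_ip u w + kp_ip v w.
Proof. by rewrite -big_split; apply: eq_bigr => i _; rewrite ffunE mulrDl. Qed.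

Lemma kp_ipZl a u w : kp_ip (a *: u) w = a * kp_ip u w.
Proof. by rewrite mulr_sumr; apply: eq_bigr => i _; rewrite ffunE mulrA. Qed.

(** Left multiplication by [kp_star x] is the adjoint of left multiplication
    by [x]; this makes the operator norm a C*-norm. *)
Lemma kp_ip_adj x u v : kp_ip (x * u) v = kp_ip u (kp_star x * v).
Proof.
rewrite /kp_ip !kp_sum !kp_mulE !ffunE /sgb /=.
rewrite !(rmorphD, rmorphM, rmorphN, rmorph1) /= !conjCK; ring.
Qed.

Lemma kp_ripC u v : kp_rip v u = kp_rip u v.
Proof. by rewrite /kp_rip kp_ipC; case: (kp_ip u v). Qed.

Lemma kp_ripDl u v w : kp_rip (u + v) w = kp_rip u w + kp_rip v w.
Proof. by rewrite /kp_rip kp_ipDl complex_ReD. Qed.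

Lemma kp_ripZl (a : R) u w : kp_rip (real_complex R a *: u) w = a * kp_rip u w.
Proof.
rewrite /kp_rip kp_ipZl; case: (kp_ip u w) => b c /=; by rewrite mul0r subr0.
Qed.

Lemma kp_rip_adj x u v : kp_rip (x * u) v = kp_rip u (kp_star x * v).
Proof. by rewrite /kp_rip kp_ip_adj. Qed.

Lemma sqr_normcE (z : C) : normc z ^+ 2 = complex.Re (z * z^*).
Proof.
case: z => a b /=; rewrite sqr_sqrtr ?addr_ge0 ?sqr_ge0 //.
by rewrite mulrN opprK !expr2.
Qed.

Lemma kp_rip_self u : kp_rip u u = \sum_i normc (u i) ^+ 2.
Proof.
rewrite /kp_rip (big_morph _ complex_ReD (erefl : complex.Re (0 : C) = 0)).
by apply: eq_bigr => i _; rewrite sqr_normcE.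
Qed.

Lemma kp_rip_ge0 u : 0 <= kp_rip u u.
Proof. by rewrite kp_rip_self sumr_ge0 // => i _; rewrite sqr_ge0. Qed.

Lemma kp_rip_eq0 u : kp_rip u u = 0 -> u = 0.
Proof.
rewrite kp_rip_self => /eqP; rewrite psumr_eq0 => [|i _]; last exact: sqr_ge0.
move=> /allP u0; apply/ffunP=> i; rewrite ffunE.
apply: ComplexField.Normc.eq0_normc; apply/eqP; rewrite -sqrf_eq0.
by apply: u0; rewrite mem_index_enum.
Qed.

Lemma kp_ripZ (a : C) u : kp_rip (a *: u) (a *: u) = normc a ^+ 2 * kp_rip u u.
Proof.
rewrite !kp_rip_self mulr_sumr; apply: eq_bigr => i _.
by rewrite ffunE ComplexField.Normc.normcM exprMn.
Qed.

Lemma kp_rip0l v : kp_rip 0 v = 0.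
Proof. by rewrite -[0](scale0r v) -[0 : C]/(real_complex R 0) kp_ripZl mul0r. Qed.

(** Expand the square norm of p v - q u, with p = <u, u> and q = <u, v>: it
    equals p (p <v, v> - q^2). *)
Lemma kp_CauchySchwarz u v : kp_rip u v ^+ 2 <= kp_rip u u * kp_rip v v.
Proof.
have [u0|un0] := eqVneq (kp_rip u u) 0.
  by rewrite (kp_rip_eq0 u0) !kp_rip0l mul0r expr0n.
have u_gt0 : 0 < kp_rip u u by rewrite lt_neqAle eq_sym un0 kp_rip_ge0.
set p := kp_rip u u in un0 u_gt0 *; set q := kp_rip u v; set r := kp_rip v v.
have := kp_rip_ge0 (real_complex R p *: v + real_complex R (- q) *: u).
rewrite kp_ripDl !kp_ripZl ![kp_rip _ (_ + _)]kp_ripC !kp_ripDl !kp_ripZl.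
rewrite [kp_rip v u]kp_ripC -/p -/q -/r => h.
rewrite -subr_ge0 -(pmulr_rge0 _ u_gt0); apply: le_trans h _.
by rewrite le_eqVlt; apply/orP; left; apply/eqP; ring.
Qed.

Lemma kp_hn_ge0 u : 0 <= kp_hn u. Proof. exact: sqrtr_ge0. Qed.

Lemma kp_hn_sqr u : kp_hn u ^+ 2 = kp_rip u u.
Proof. by rewrite sqr_sqrtr // kp_rip_ge0. Qed.

Lemma kp_rip_le u v : kp_rip u v <= kp_hn u * kp_hn v.
Proof.
apply: le_trans (ler_norm _) _; rewrite -ler_sqr ?nnegrE ?mulr_ge0 ?kp_hn_ge0 //.
by rewrite real_normK ?num_real // exprMn !kp_hn_sqr kp_CauchySchwarz.
Qed.

Lemma kp_hnD u v : kp_hn (u + v) <= kp_hn u + kp_hn v.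
Proof.
rewrite -ler_sqr ?nnegrE ?addr_ge0 ?kp_hn_ge0 //.
rewrite kp_hn_sqr sqrrD !kp_hn_sqr kp_ripDl ![kp_rip _ (u + v)]kp_ripC !kp_ripDl.
by rewrite [kp_rip v u]kp_ripC; have := kp_rip_le u v; lra.
Qed.

Lemma kp_hnZ (a : C) u : kp_hn (a *: u) = normc a * kp_hn u.
Proof.
rewrite /kp_hn kp_ripZ sqrtrM ?sqr_ge0 // sqrtr_sqr ger0_norm //.
by case: a => ? ?; apply: sqrtr_ge0.
Qed.

Lemma kp_hn_eq0 u : kp_hn u = 0 -> u = 0.
Proof. by move=> u0; apply: kp_rip_eq0; rewrite -kp_hn_sqr u0 expr0n. Qed.

Lemma normc_ge0 (z : C) : 0 <= normc z.
Proof. by case: z => a b; apply: sqrtr_ge0. Qed.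

Lemma kp_normc_le u i : normc (u i) <= kp_hn u.
Proof.
rewrite -ler_sqr ?nnegrE ?kp_hn_ge0 ?normc_ge0 // kp_hn_sqr kp_rip_self.
by rewrite (bigD1 i) //= lerDl sumr_ge0 // => j _; rewrite sqr_ge0.
Qed.

(** A crude bound, which only serves to show that the supremum defining the
    operator norm is finite: each of the 8 coordinates of x v has modulus at most
    2 |x| |v|, so that the square norm is at most 32 |x|^2 |v|^2. *)
Lemma kp_hn_mul_le x v : kp_hn (x * v) <= 8 * kp_hn x * kp_hn v.
Proof.
have xv_ge0 : 0 <= kp_hn x * kp_hn v by rewrite mulr_ge0 ?kp_hn_ge0.
have xvi i : normc ((x * v) i) ^+ 2 <= (2 * (kp_hn x * kp_hn v)) ^+ 2.
  rewrite ler_sqr ?nnegrE ?normc_ge0 ?mulr_ge0 ?kp_hn_ge0 //.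
  have term (a : C) j l : normc a = 1 ->
      normc (a * (x j * v l)) <= kp_hn x * kp_hn v.
    move=> a1; rewrite !ComplexField.Normc.normcM a1 mul1r.
    by rewrite ler_pM ?normc_ge0 ?kp_normc_le.
  case: i => [[s t] k]; rewrite kp_mulE mulr_natl mulr2n.
  apply: le_trans (le_normcD _ _) _; apply: lerD; last first.
    apply: term; rewrite /sgb; case: ifP => _.
      by rewrite normcN ComplexField.Normc.normc1.
    exact: ComplexField.Normc.normc1.
  by rewrite -[X in normc X]mul1r term // ComplexField.Normc.normc1.
rewrite -ler_sqr ?nnegrE ?kp_hn_ge0 ?mulr_ge0 ?kp_hn_ge0 //.
rewrite kp_hn_sqr kp_rip_self; apply: le_trans (ler_sum _ (fun i _ => xvi i)) _.
rewrite kp_sum -mulrA; move: (kp_hn x * kp_hn v) xv_ge0 => a a0.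
by have := sqr_ge0 a; rewrite !exprMn; lra.
Qed.

(** The vector v = 0 contributes the harmless value 0 / 0 = 0. *)
Definition kp_norm x : R :=
  sup [set r | exists v, r = kp_hn (x * v) / kp_hn v]%classic.

Lemma kp_norm_bound x v : kp_hn (x * v) <= kp_norm x * kp_hn v.
Proof.
have [v0|v_neq0] := eqVneq (kp_hn v) 0.
  rewrite v0 mulr0 (kp_hn_eq0 v0) mulr0.
  by rewrite /kp_hn kp_rip0l sqrtr0.
have v_gt0 : 0 < kp_hn v by rewrite lt_neqAle eq_sym v_neq0 kp_hn_ge0.
rewrite -ler_pdivrMr //; apply: ub_le_sup; last by exists v.
exists (8 * kp_hn x) => _ [w ->].
have [w0|w_neq0] := eqVneq (kp_hn w) 0.
  by rewrite w0 invr0 mulr0 mulr_ge0 ?kp_hn_ge0.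
by rewrite ler_pdivrMr ?kp_hn_mul_le // lt_neqAle eq_sym w_neq0 kp_hn_ge0.
Qed.

Lemma kp_norm_le x c : 0 <= c ->
  (forall v, kp_hn (x * v) <= c * kp_hn v) -> kp_norm x <= c.
Proof.
move=> c_ge0 xc; apply: ge_sup; first by exists (kp_hn (x * 0) / kp_hn 0); exists 0.
move=> _ [w ->].
have [w0|w_neq0] := eqVneq (kp_hn w) 0; first by rewrite w0 invr0 mulr0.
by rewrite ler_pdivrMr // lt_neqAle eq_sym w_neq0 kp_hn_ge0.
Qed.

Lemma kp_norm_ge0 x : 0 <= kp_norm x.
Proof.
have one_gt0 : 0 < kp_hn 1.
  rewrite lt_neqAle kp_hn_ge0 andbT eq_sym; apply/eqP => /kp_hn_eq0/eqP.
  by rewrite oner_eq0.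
rewrite -(pmulr_lge0 _ one_gt0).
by apply: le_trans (kp_norm_bound x 1); apply: kp_hn_ge0.
Qed.

Lemma kp_normZ_le (a : C) x : kp_norm (a *: x) <= normc a * kp_norm x.
Proof.
apply: kp_norm_le => [|v]; first by rewrite mulr_ge0 ?normc_ge0 ?kp_norm_ge0.
by rewrite -scalerAl kp_hnZ -mulrA ler_wpM2l ?normc_ge0 ?kp_norm_bound.
Qed.

Lemma kp_normM x y : kp_norm (x * y) <= kp_norm x * kp_norm y.
Proof.
apply: kp_norm_le => [|v]; first by rewrite mulr_ge0 ?kp_norm_ge0.
rewrite -mulrA; apply: le_trans (kp_norm_bound x _) _.
by rewrite -mulrA ler_wpM2l ?kp_norm_ge0 ?kp_norm_bound.
Qed.

(** |x^* v|^2 = <x x^* v, v> is at most |x| |x^* v| |v|. *)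
Lemma kp_norm_star_le x : kp_norm (kp_star x) <= kp_norm x.
Proof.
apply: kp_norm_le => [|v]; first exact: kp_norm_ge0.
have [_ _ _ starK] := kp_starP R.
set y := kp_star x * v.
have [y0|y_neq0] := eqVneq (kp_hn y) 0.
  by rewrite y0 mulr_ge0 ?kp_norm_ge0 ?kp_hn_ge0.
have y_gt0 : 0 < kp_hn y by rewrite lt_neqAle eq_sym y_neq0 kp_hn_ge0.
rewrite -(ler_pM2r y_gt0) -expr2 kp_hn_sqr {1}/y kp_rip_adj starK kp_ripC.
apply: le_trans (kp_rip_le _ _) _.
rewrite mulrAC.
by rewrite ler_wpM2r ?kp_hn_ge0 ?kp_norm_bound.
Qed.

(** The C*-identity combines [kp_norm_star_le] with
    |x v|^2 = <x^* x v, v>, which is at most |x^* x| |v|^2. *)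
Lemma kp_normP : is_Cstar_norm (@kp_star R) kp_norm.
Proof.
split=> [x x0|x y|a x|x y|x].
- apply: kp_hn_eq0; apply/eqP; rewrite eq_le kp_hn_ge0 andbT.
  by have := kp_norm_bound x 1; rewrite mulr1 x0 mul0r.
- apply: kp_norm_le => [|v]; first by rewrite addr_ge0 ?kp_norm_ge0.
  rewrite mulrDl mulrDl; apply: le_trans (kp_hnD _ _) _.
  by rewrite lerD ?kp_norm_bound.
- apply/eqP; rewrite eq_le kp_normZ_le /=.
  have [->|a0] := eqVneq a 0.
    by rewrite ComplexField.Normc.normc0 mul0r kp_norm_ge0.
  have na : 0 < normc a.
    rewrite lt_neqAle normc_ge0 andbT eq_sym.
    by apply: contra_neq a0; apply: ComplexField.Normc.eq0_normc.
  rewrite -{1}[x]scale1r -(mulVf a0) -scalerA -ler_pdivlMl //.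
  by rewrite -ComplexField.Normc.normcV kp_normZ_le.
- exact: kp_normM.
- apply/eqP; rewrite eq_le; apply/andP; split.
    apply: le_trans (kp_normM _ _) _.
    by rewrite expr2 ler_wpM2r ?kp_norm_ge0 ?kp_norm_star_le.
  rewrite -[leRHS]sqr_sqrtr ?kp_norm_ge0 //.
  rewrite ler_sqr ?nnegrE ?kp_norm_ge0 ?sqrtr_ge0 //.
  apply: kp_norm_le => [|v]; first exact: sqrtr_ge0.
  rewrite -ler_sqr ?nnegrE ?mulr_ge0 ?kp_hn_ge0 ?sqrtr_ge0 //.
  rewrite exprMn [X in _ <= X * _]sqr_sqrtr ?kp_norm_ge0 //.
  rewrite [leLHS]kp_hn_sqr kp_rip_adj mulrA kp_ripC.
  apply: le_trans (kp_rip_le _ _) _.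
  by rewrite expr2 mulrA ler_wpM2r ?kp_hn_ge0 ?kp_norm_bound.
Qed.
End Norm.

(** * Slices and Fourier coefficients *)

Section Coideal.
Variable R : realType.
Local Notation C := (R[i]).
Local Notation kp := (kp_alg R).
Local Notation sgb := (sgb R).
Implicit Types (w u v : kp) (I : {vspace kp}).

(** The slice of the coproduct by the coordinate functional i; see
    [slice_kp_Delta]. *)
Definition kp_slice (i : kp_index) w : kp := [ffun j => kp_coef w i j].

Lemma kp_decomp_basis u : u = \sum_j u j *: kp_e R j.
Proof.
apply/ffunP=> i; rewrite -[LHS]/(kp_ev i u) -[RHS]/(kp_ev i _) linear_sum /=.
rewrite (bigD1 i) //= big1 ?addr0 => [|j ji]; rewrite linearZ /= kp_ev_e.
  by rewrite eqxx /GRing.scale /= mulr1.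
by rewrite eq_sym (negPf ji) scaler0.
Qed.

Lemma kp_Delta_slice w : kp_Delta w = \sum_i tensor (kp_e R i) (kp_slice i w).
Proof.
apply: eq_bigr => i _; rewrite [kp_slice i w]kp_decomp_basis linear_sum.
by apply: eq_bigr => j _; rewrite linearZ ffunE.
Qed.

Lemma slice_kp_Delta i w : slice (kp_ev i) (kp_Delta w) = kp_slice i w.
Proof.
rewrite kp_Delta_slice linear_sum (bigD1 i) //= big1 ?addr0 => [|j ji].
  by rewrite slice_tensor /= kp_ev_e eqxx scale1r.
by rewrite slice_tensor /= kp_ev_e eq_sym (negPf ji) scale0r.
Qed.

(** The coideal condition in terms of slices: they generate all
    the slices (phi tensor id) Delta. *)
Definition kp_coideal I : Prop :=
  [/\ 1 \in I, forall u v, u \in I -> v \in I -> u * v \in I,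
      forall u, u \in I -> kp_star u \in I
    & forall u, u \in I -> forall i, kp_slice i u \in I].

(** The grouplike element x^i y^j. *)
Definition kp_gl (i j : bool) : kp := [ffun p : kp_index =>
  if p.2 then 0 else sgb ((i && p.1.1) (+) (j && p.1.2))].
Local Notation gl := kp_gl.
(** The element a z + b yz. *)
Definition kp_qz (a b : C) : kp := [ffun p : kp_index =>
  if p.2 then a + b * sgb p.1.2 else 0].
(** The element a xz + b xyz. *)
Definition kp_qx (a b : C) : kp := [ffun p : kp_index =>
  if p.2 then sgb p.1.1 * (a + b * sgb p.1.2) else 0].

(** The coefficient of x^i y^j z^k, obtained by Fourier inversion on
    Z/2 x Z/2. *)
Definition kp_fcoef (k i j : bool) w : C^o := 4^-1 *
  (w (false, false, k) + sgb i * w (true, false, k) +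
   sgb j * w (false, true, k) + sgb (i (+) j) * w (true, true, k)).
Local Notation ga := (kp_fcoef false).
Local Notation gb := (kp_fcoef true).

Fact kp_fcoef_linear k i j : linear (kp_fcoef k i j).
Proof. by move=> a u v; rewrite /kp_fcoef !ffunE /GRing.scale /=; ring. Qed.
HB.instance Definition _ k i j := GRing.isLinear.Build C kp C^o _ (kp_fcoef k i j)
  (kp_fcoef_linear k i j).

Lemma kp_sum6E (a0 a1 a2 a3 : C) (p0 p1 p2 p3 p4 p5 : kp) i :
  (a0 *: p0 + a1 *: p1 + a2 *: p2 + a3 *: p3 + p4 + p5) i =
  a0 * p0 i + a1 * p1 i + a2 * p2 i + a3 * p3 i + p4 i + p5 i.
Proof. by rewrite !ffunE. Qed.

Lemma kp_fourier w : w = ga false false w *: gl false false +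
    ga true false w *: gl true false + ga false true w *: gl false true +
    ga true true w *: gl true true +
    kp_qz (gb false false w) (gb false true w) + kp_qx (gb true false w) (gb true true w).
Proof.
apply/ffunP=> i; rewrite kp_sum6E !ffunE /kp_fcoef.
by case: i => [[[] []] []]; rewrite /sgb /=; field.
Qed.

Lemma kp_gl00 : gl false false = 1.
Proof. by kp_ext. Qed.

Lemma kp_glM i j k l : gl i j * gl k l = gl (i (+) k) (j (+) l).
Proof. by kp_ext; case: i j k l => [] [] [] []; rewrite /sgb /=; ring. Qed.

(** The functional dual to x^i y^j slices w to its x^i y^j component,
    because x^i y^j is grouplike. *)
Lemma kp_mem_gl I w i j : kp_coideal I -> w \in I -> ga i j w *: gl i j \in I.
Proof.
case=> _ _ _ Isl wI.
suff -> : ga i j w *: gl i j = 4^-1 *: (kp_slice (false, false, false) w +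
    sgb i *: kp_slice (true, false, false) w +
    sgb j *: kp_slice (false, true, false) w +
    sgb (i (+) j) *: kp_slice (true, true, false) w).
  by rewrite !(memvZ, memvD, Isl).
by kp_ext; rewrite /kp_fcoef /kp_coef /GRing.scale /=;
  case: i j => [] []; rewrite /sgb /=; field.
Qed.

(** Write e0, e1 for the idempotents (1 + y)/2 and (1 - y)/2. Since
    Delta(z) = e0 z tensor z + e1 z tensor xz, the functionals dual to e0 z, e1 z,
    x e0 z and x e1 z slice w to the four elements below. *)
Lemma kp_mem_qz I w : kp_coideal I -> w \in I ->
  [/\ kp_qz (gb false false w) (gb false true w) \in I,
      kp_qx (gb false false w) (- gb false true w) \in I,
      kp_qx (gb true false w) (gb true true w) \in I
    & kp_qz (gb true false w) (- gb true true w) \in I].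
Proof.
case=> _ _ _ Isl wI; split.
- suff -> : kp_qz (gb false false w) (gb false true w) = 2^-1 *:
   (kp_slice (false, false, true) w + kp_slice (true, false, true) w).
    by rewrite !(memvZ, memvD, Isl).
  by kp_ext; rewrite /kp_fcoef /kp_coef /GRing.scale /= /sgb /=; field.
- suff -> : kp_qx (gb false false w) (- gb false true w) = 2^-1 *:
   (kp_slice (false, true, true) w + kp_slice (true, true, true) w).
    by rewrite !(memvZ, memvD, Isl).
  by kp_ext; rewrite /kp_fcoef /kp_coef /GRing.scale /= /sgb /=; field.
- suff -> : kp_qx (gb true false w) (gb true true w) = 2^-1 *:
   (kp_slice (false, false, true) w - kp_slice (true, false, true) w).
    by rewrite !(memvZ, memvB, Isl).
  by kp_ext; rewrite /kp_fcoef /kp_coef /GRing.scale /= /sgb /=; field.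
- suff -> : kp_qz (gb true false w) (- gb true true w) = 2^-1 *:
   (kp_slice (false, true, true) w - kp_slice (true, true, true) w).
    by rewrite !(memvZ, memvB, Isl).
  by kp_ext; rewrite /kp_fcoef /kp_coef /GRing.scale /= /sgb /=; field.
Qed.
End Coideal.

(** * The six intermediate coideal subalgebras *)

Section Coideal.
Variable R : realType.
Local Notation C := (R[i]).
Local Notation kp := (kp_alg R).
Local Notation sgb := (sgb R).
Implicit Types (w u v : kp) (I : {vspace kp}).
Local Notation ga := (kp_fcoef false).
Local Notation gb := (kp_fcoef true).
Local Notation gl := (kp_gl R).

Fact kp_slice_linear (i : kp_index) : linear (@kp_slice R i).
Proof. by move=> a u v; apply/ffunP=> j; rewrite !ffunE; apply: kp_coef_linear. Qed.
HB.instance Definition _ i := GRing.isLinear.Build C kp kp _ (kp_slice i)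
  (kp_slice_linear i).

Lemma kp_star_sum (J : finType) (a : J -> C) (f : J -> kp) :
  kp_star (\sum_j a j *: f j) = \sum_j (a j)^* *: kp_star (f j).
Proof.
have [sD sZ _ _] := kp_starP R.
have s0 : kp_star (0 : kp) = 0.
  by rewrite -[X in kp_star X](scale0r 0) sZ rmorph0 scale0r.
by rewrite (big_morph _ sD s0); apply: eq_bigr => j _; rewrite sZ.
Qed.

(** The coideal conditions are linear or antilinear in each argument, so they
    can be tested on a spanning family. *)
Lemma kp_coideal_span (X : seq kp) :
    1 \in <<X>>%VS ->
    (forall u v, u \in X -> v \in X -> u * v \in <<X>>%VS) ->
    (forall u, u \in X -> kp_star u \in <<X>>%VS) ->
    (forall u, u \in X -> forall i, kp_slice i u \in <<X>>%VS) ->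
  kp_coideal <<X>>%VS.
Proof.
move=> X1 XM Xs Xsl.
have XE u : u \in <<X>>%VS -> u = \sum_i coord (in_tuple X) i u *: X`_i.
  exact: (@coord_span _ _ _ (in_tuple X)).
have Xi (i : 'I_(size X)) : X`_i \in X by rewrite mem_nth.
split=> // [u v|u|u] /XE->.
- move=> /XE->; rewrite mulr_suml memv_suml // => i _.
  rewrite mulr_sumr memv_suml // => j _.
  by rewrite -scalerAl -scalerAr !memvZ ?XM.
- by rewrite kp_star_sum memv_suml // => i _; rewrite memvZ ?Xs.
- by move=> j; rewrite linear_sum memv_suml // => i _; rewrite linearZ memvZ ?Xsl.
Qed.

Lemma kp_star_gl i j : kp_star (gl i j) = gl i j.
Proof. by kp_ext; rewrite ?mulr0 ?rmorph0 ?sgb_conj ?mulr0 //; case: i j => [] []. Qed.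

Lemma kp_slice_gl i a b :
  kp_slice i (gl a b) =
    (if i.2 then 0 else sgb ((a && i.1.1) (+) (b && i.1.2))) *: gl a b.
Proof.
case: i => [[s t] k]; kp_ext;
by case: s t k a b => [] [] [] [] [];
  rewrite /kp_coef /sgb /GRing.scale /= ?ffunE /=; ring.
Qed.

Definition kp_I (i j : bool) : {vspace kp} := <<[:: gl false false; gl i j]>>.
Definition kp_J0 : {vspace kp} :=
  <<[:: gl false false; gl true false; gl false true; gl true true]>>.
(** The generators are 1, g = xy, p = z + e yz and q = xz - e xyz. With
    e^2 = -1 the last two are exchanged by g up to scalars, and p spans with q a
    two-dimensional subcomodule. *)
Definition kp_J (e : C) : {vspace kp} :=
  <<[:: gl false false; gl true true; kp_qz 1 e; kp_qx 1 (- e)]>>.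

Lemma kp_I_coideal i j : kp_coideal (kp_I i j).
Proof.
have g0 : gl false false \in kp_I i j by rewrite memv_span ?inE ?eqxx ?orbT.
have g1 : gl i j \in kp_I i j by rewrite memv_span ?inE ?eqxx ?orbT.
apply: kp_coideal_span; rewrite -/(kp_I i j).
- by rewrite -kp_gl00.
- by move=> u v; rewrite !inE => /orP[] /eqP-> /orP[] /eqP->;
    rewrite kp_glM ?addbb //= ?addbF.
- by move=> u; rewrite !inE => /orP[] /eqP->; rewrite kp_star_gl.
- by move=> u; rewrite !inE => /orP[] /eqP-> p; rewrite kp_slice_gl memvZ.
Qed.

Lemma kp_gl_J0 i j : gl i j \in kp_J0.
Proof. by rewrite memv_span // !inE; case: i j => [] []; rewrite eqxx ?orbT. Qed.

Lemma kp_J0_coideal : kp_coideal kp_J0.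
Proof.
apply: kp_coideal_span; rewrite -/kp_J0.
- by rewrite -kp_gl00 kp_gl_J0.
- by move=> u v; rewrite !inE => /or4P[] /eqP-> /or4P[] /eqP->; rewrite kp_glM kp_gl_J0.
- by move=> u; rewrite !inE => /or4P[] /eqP->; rewrite kp_star_gl kp_gl_J0.
- by move=> u; rewrite !inE => /or4P[] /eqP-> p; rewrite kp_slice_gl memvZ ?kp_gl_J0.
Qed.

Lemma kp_lin2E (a b : C) (p q : kp) i : (a *: p + b *: q) i = a * p i + b * q i.
Proof. by rewrite !ffunE. Qed.

Section J.
Variable e : C.
Hypothesis e2 : e * e = -1.
Hypothesis ec : e^* = - e.

(** The relation g p = e q uses that xy (z + e yz) = e xz + xyz, which is a
    multiple of q exactly when e^2 = -1. *)
Lemma kp_JM : let g := gl true true in let p := kp_qz 1 e in let q := kp_qx 1 (- e) in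
  [/\ g * p = e *: q, p * g = e *: q, g * q = - e *: p & q * g = - e *: p] /\
  [/\ p * p = (1 + e) *: gl false false + (e - 1) *: g,
      p * q = (1 + e) *: gl false false + (1 - e) *: g,
      q * p = (1 + e) *: gl false false + (1 - e) *: g
    & q * q = - (1 + e) *: gl false false + (1 - e) *: g].
Proof.
split; split; apply/ffunP; kp_cases;
by rewrite ?kp_lin2E !ffunE /sgb /GRing.scale /=; ring: e2.
Qed.

Lemma kp_J_star : kp_star (kp_qz 1 e) = (2^-1 * (1 - e)) *: (kp_qz 1 e + kp_qx 1 (- e)) /\
  kp_star (kp_qx 1 (- e)) = (2^-1 * (1 - e)) *: (kp_qz 1 e - kp_qx 1 (- e)).
Proof.
by split; kp_ext; rewrite ?rmorph0 /sgb /GRing.scale /= ?rmorphM ?rmorphD ?rmorphM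
  ?rmorphN ?rmorphM ?rmorph1 /= ?ec; field: e2.
Qed.

Lemma kp_J_slice i :
  kp_slice i (kp_qz 1 e) =
    (if i.2 then 1 else 0) *: (if i.1.2 then kp_qx 1 (- e) else kp_qz 1 e) /\
  kp_slice i (kp_qx 1 (- e)) =
    (if i.2 then sgb i.1.1 else 0) *: (if i.1.2 then kp_qz 1 e else kp_qx 1 (- e)).
Proof.
by case: i => [[s t] k]; split; kp_ext;
case: s t k => [] [] []; rewrite /kp_coef /sgb /GRing.scale /= ?ffunE /=; ring.
Qed.

Lemma kp_J_coideal : kp_coideal (kp_J e).
Proof.
have /and4P[g0 g1 p q] : [&& 1 \in kp_J e, gl true true \in kp_J e, kp_qz 1 e \in kp_J e
   & kp_qx 1 (- e) \in kp_J e].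
  by rewrite -kp_gl00 !memv_span ?inE ?eqxx ?orbT.
have [[gp pg gq qg] [pp pq qp qq]] := kp_JM; have [sp sq] := kp_J_star.
have gg : gl true true * gl true true = 1 by rewrite kp_glM -kp_gl00.
apply: kp_coideal_span; rewrite -/(kp_J e) //.
- move=> u v; rewrite kp_gl00 !inE => /or4P[] /eqP-> /or4P[] /eqP->;
  by rewrite ?mul1r ?mulr1 // ?gg // ?gp ?pg ?gq ?qg ?pp ?pq ?qp ?qq
    ?kp_gl00 !(memvD, memvZ).
- move=> u; rewrite !inE => /or4P[] /eqP->; rewrite ?kp_star_gl ?sp ?sq ?kp_gl00 //.
    by rewrite !(memvD, memvZ).
  by rewrite !(memvB, memvZ).
- move=> u; rewrite !inE => uX i; have [slp slq] := kp_J_slice i.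
  case/or4P: uX => /eqP->; rewrite ?kp_slice_gl ?slp ?slq memvZ ?kp_gl00 //;
  by case: ifP.
Qed.
End J.
End Coideal.

(** * Classification of coideal subalgebras *)

Section Coideal.
Variable R : realType.
Local Notation C := (R[i]).
Local Notation kp := (kp_alg R).
Local Notation sgb := (sgb R).
Implicit Types (w u v : kp) (I : {vspace kp}).
Local Notation ga := (kp_fcoef false).
Local Notation gb := (kp_fcoef true).
Local Notation gl := (kp_gl R).

(** Used with Fourier coefficients, which vanish on all but one of the
    generators in play, to show that an element lies outside a span. *)
Lemma kp_sep (X : seq kp) (phi : {linear kp -> C^o}) v :
  (forall u, u \in X -> phi u = 0) -> v \in <<X>>%VS -> phi v = 0.
Proof.
move=> phi0 /(@coord_span _ _ _ (in_tuple X))->; rewrite linear_sum big1 // => i _.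
by rewrite linearZ /= phi0 ?scaler0 //; apply: mem_nth.
Qed.

Lemma kp_fcoef_gl k i j a b :
  kp_fcoef k i j (gl a b) = ([&& ~~ k, i == a & j == b])%:R.
Proof.
by rewrite /kp_fcoef !ffunE; case: k i j a b => [] [] [] [] []; rewrite /sgb /=; field.
Qed.

Lemma kp_fcoef_qz k i j (a b : C) :
  kp_fcoef k i j (kp_qz a b) = if k && ~~ i then (if j then b else a) else 0.
Proof.
by rewrite /kp_fcoef !ffunE; case: k i j => [] [] []; rewrite /sgb /=; field.
Qed.

Lemma kp_fcoef_qx k i j (a b : C) :
  kp_fcoef k i j (kp_qx a b) = if k && i then (if j then b else a) else 0.
Proof.
by rewrite /kp_fcoef !ffunE; case: k i j => [] [] []; rewrite /sgb /=; field.
Qed.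

Definition kp_fcoefE := (kp_fcoef_gl, kp_fcoef_qz, kp_fcoef_qx).

Section Closure.
Variable I : {vspace kp}.
Hypothesis coI : kp_coideal I.

Lemma mem_glZ i j w : w \in I -> ga i j w != 0 -> gl i j \in I.
Proof.
move=> wI gn0; rewrite -[gl i j]scale1r -(mulVf gn0) -scalerA memvZ //.
exact: kp_mem_gl.
Qed.

(** Both elements are slices of [kp_qz a b]. *)
Lemma mem_qz_qx (a b : C) : kp_qz a b \in I -> kp_qx a (- b) \in I.
Proof. by move=> /(kp_mem_qz coI) []; rewrite !kp_fcoefE. Qed.

Lemma qz_mem_coef w : w \in I -> kp_qz (gb false false w) (gb false true w) \in I.
Proof. by move=> /(kp_mem_qz coI) []. Qed.

Lemma qx_mem_coef w : w \in I -> kp_qz (gb true false w) (- gb true true w) \in I.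
Proof. by move=> /(kp_mem_qz coI) []. Qed.

(** Once z is in I, so is z^2 = (1 + x + y - xy) / 2, hence all four
    grouplikes; then z and yz give the rest. *)
Lemma kp_full : kp_qz 1 0 \in I -> kp_qz 0 1 \in I -> I = fullv.
Proof.
case: (coI) => _ IM _ _ z_I yz_I.
have zzE i j : ga i j (kp_qz 1 0 * kp_qz 1 0) = if i && j then - 2^-1 else 2^-1.
  by rewrite /kp_fcoef !kp_mulE !ffunE; case: i j => [] []; rewrite /sgb /=; field.
have h2 : 2^-1 != 0 :> C by rewrite invr_neq0 ?pnatr_eq0.
have glI i j : gl i j \in I.
  by apply: (mem_glZ (IM _ _ z_I z_I)); rewrite zzE; case: ifP; rewrite ?oppr_eq0.
have qzE a b : kp_qz a b = a *: kp_qz 1 0 + b *: kp_qz 0 1 :> kp.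
  by kp_ext; rewrite /GRing.scale /=; ring.
have qzI a b : kp_qz a b \in I by rewrite qzE memvD ?memvZ.
apply/eqP; rewrite eqEsubv subvf; apply/subvP=> w _.
rewrite (kp_fourier w) !(memvD, memvZ) //.
by rewrite -[X in kp_qx _ X]opprK mem_qz_qx.
Qed.

(** Adding and subtracting the sign changes splits the pairs (a, b) and (b, a)
    into their components, one of which is nonzero; up to scalars they contain
    both (1, 0) and (0, 1). *)
Lemma qz_spread (a b : C) : (a != 0) || (b != 0) -> kp_qz a b \in I -> kp_qz b a \in I ->
  (forall c d, kp_qz c d \in I -> kp_qz c (- d) \in I) -> I = fullv.
Proof.
move=> ab0 abI baI sgI.
have qzD c d c' d' : kp_qz c d + kp_qz c' d' = kp_qz (c + c') (d + d') :> kp.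
  by kp_ext; ring.
have qzZ c d d' : c *: kp_qz d d' = kp_qz (c * d) (c * d') :> kp.
  by kp_ext; rewrite /GRing.scale /=; ring.
have fstI c d : kp_qz c d \in I -> kp_qz c 0 \in I.
  move=> cdI; rewrite (_ : kp_qz c 0 = 2^-1 *: (kp_qz c d + kp_qz c (- d))).
    by rewrite memvZ ?memvD ?sgI.
  by rewrite qzD qzZ; congr kp_qz; field.
have sndI c d : kp_qz c d \in I -> kp_qz 0 d \in I.
  move=> cdI; rewrite (_ : kp_qz 0 d = kp_qz c d - kp_qz c 0).
    by rewrite memvB ?(fstI _ d).
  by kp_ext; ring.
have qz1 c : c != 0 -> kp_qz c 0 \in I -> kp_qz 0 c \in I -> I = fullv.
  move=> c0 c0I cI; apply: kp_full.
    rewrite (_ : kp_qz 1 0 = c^-1 *: kp_qz c 0) ?memvZ // qzZ mulVf //.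
    by rewrite mulr0.
  rewrite (_ : kp_qz 0 1 = c^-1 *: kp_qz 0 c) ?memvZ // qzZ mulVf //.
  by rewrite mulr0.
by case/orP: ab0 => /qz1; apply; [apply: fstI abI | apply: sndI baI |
  apply: fstI baI | apply: sndI abI].
Qed.

(** Here x (a z + b yz) = a xz + b xyz yields the sign change of b by slicing,
    and (a z + b yz) x = b z + a yz. *)
Lemma kp_full_x (a b : C) : gl true false \in I -> (a != 0) || (b != 0) ->
  kp_qz a b \in I -> I = fullv.
Proof.
case: (coI) => _ IM _ _ xI ab0 abI.
have xqz c d : gl true false * kp_qz c d = kp_qx c d :> kp.
  by kp_ext; rewrite /sgb /=; ring.
have qzx c d : kp_qz c d * gl true false = kp_qz d c :> kp.
  by kp_ext; rewrite /sgb /=; ring.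
apply: (qz_spread ab0 abI) => [|c d cdI]; first by rewrite -qzx IM.
have /qx_mem_coef : gl true false * kp_qz c d \in I by rewrite IM.
by rewrite xqz !kp_fcoefE.
Qed.

(** The two sides exchange their roles with respect to [kp_full_x]. *)
Lemma kp_full_y (a b : C) : gl false true \in I -> (a != 0) || (b != 0) ->
  kp_qz a b \in I -> I = fullv.
Proof.
case: (coI) => _ IM _ _ yI ab0 abI.
have yqz c d : gl false true * kp_qz c d = kp_qz d c :> kp.
  by kp_ext; rewrite /sgb /=; ring.
have qzy c d : kp_qz c d * gl false true = kp_qx c d :> kp.
  by kp_ext; rewrite /sgb /=; ring.
apply: (qz_spread ab0 abI) => [|c d cdI]; first by rewrite -yqz IM.
have /qx_mem_coef : kp_qz c d * gl false true \in I by rewrite IM.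
by rewrite qzy !kp_fcoefE.
Qed.

Lemma kp_fcoef_qz_sqr (a b : C) :
  ga true false (kp_qz a b * kp_qz a b) = 2^-1 * (a * a + b * b) /\
  ga true true (kp_qz a b * kp_qz a b) = 2^-1 * (b * b - a * a + 2 * (a * b)).
Proof.
by split; rewrite /kp_fcoef !kp_mulE !ffunE /sgb /=; field.
Qed.

(** The square of a z + b yz has x-coefficient (a^2 + b^2) / 2. *)
Lemma mem_qz_isotropic (a b : C) : gl true false \notin I -> kp_qz a b \in I ->
  a * a + b * b = 0.
Proof.
move=> xI abI; case: (coI) => _ IM _ _; apply/eqP; apply: contraNT xI => ab0.
apply: (mem_glZ (IM _ _ abI abI)); rewrite (kp_fcoef_qz_sqr a b).1.
by rewrite mulf_neq0 // invr_neq0 ?pnatr_eq0.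
Qed.

(** The pairs (c, d) with c z + d yz in I form a subspace on which
    c^2 + d^2 vanishes; it contains (1, e), hence is the line through it, since
    the difference (0, d - e c) is isotropic too. *)
Lemma kp_J_eq (a b : C) : gl true false \notin I -> gl false true \notin I ->
    (a != 0) || (b != 0) -> kp_qz a b \in I ->
  exists2 e : C, e * e = -1 & I = kp_J e.
Proof.
move=> xI yI ab0 abI; have iso := mem_qz_isotropic xI; case: (coI) => _ IM _ _.
have a0 : a != 0.
  apply: contraTneq ab0 => a0; move: (iso _ _ abI); rewrite a0 mul0r add0r.
  by move/eqP; rewrite mulf_eq0 orbb => /eqP->; rewrite eqxx.
(* Normalize the first coefficient to 1; then e^2 = -1 by isotropy. *)
pose e := b / a.
have pI : kp_qz 1 e \in I.
  rewrite (_ : kp_qz 1 e = a^-1 *: kp_qz a b) ?memvZ //.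
  by kp_ext; rewrite /GRing.scale /= /e; field.
have e2 : e * e = -1 by apply/eqP; rewrite -addr_eq0 addrC -{1}[1]mulr1 iso.
exists e => //; have qI := mem_qz_qx pI.
have gI : gl true true \in I.
  apply: (mem_glZ (IM _ _ pI pI)); rewrite (kp_fcoef_qz_sqr 1 e).2 e2.
  (* The coefficient of xy in the square of z + e yz is e - 1. *)
  rewrite !mul1r (_ : -1 - 1 + 2 * e = 2 * (e - 1)); last by ring.
  rewrite mulKf ?pnatr_eq0 // subr_eq0; apply/eqP=> e1; move/eqP: e2.
  by rewrite e1 mulr1 -addr_eq0 -mulr2n pnatr_eq0.
have oneI : gl false false \in I by rewrite kp_gl00; case: coI.
apply/eqP; rewrite eqEsubv; apply/andP; split; last first.
  by apply/span_subvP=> u; rewrite !inE => /or4P[] /eqP->.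
have qzJ c d : kp_qz c d \in I -> kp_qz c d = c *: kp_qz 1 e.
  move=> cdI; have: kp_qz c d - c *: kp_qz 1 e \in I by rewrite memvB ?memvZ.
  have -> : kp_qz c d - c *: kp_qz 1 e = kp_qz 0 (d - c * e).
    by kp_ext; rewrite /GRing.scale /=; ring.
  move/iso; rewrite mul0r add0r => /eqP; rewrite mulf_eq0 orbb subr_eq0 => /eqP->.
  by kp_ext; rewrite /GRing.scale /=; ring.
have /and4P[J0 Jg Jp Jq] : [&& gl false false \in kp_J e, gl true true \in kp_J e,
     kp_qz 1 e \in kp_J e & kp_qx 1 (- e) \in kp_J e].
  by rewrite !memv_span ?inE ?eqxx ?orbT.
have gl_out i j w : w \in I -> gl i j \notin I -> ga i j w = 0.
  by move=> wI; apply: contraNeq; apply: mem_glZ wI.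
apply/subvP=> w wI; rewrite (kp_fourier w).
rewrite (gl_out true false) // (gl_out false true) // !scale0r !addr0.
rewrite (qzJ _ _ (qz_mem_coef wI)).
(* The part c xz + d xyz of w is controlled by its slice c z - d yz. *)
have := qzJ _ _ (qx_mem_coef wI); set c := gb true false w; set d := gb true true w.
move=> qzE; have -> : kp_qx c d = c *: kp_qx 1 (- e).
  have dE : - d = c * e.
    by rewrite -[LHS](kp_fcoef_qz true false true c (- d)) qzE linearZ /= !kp_fcoefE.
  by rewrite -[d]opprK dE; kp_ext; rewrite /GRing.scale /=; ring.
by rewrite !(memvD, memvZ).
Qed.

(** Without elements of the form a z + b yz, a coideal subalgebra lies in the
    span of its grouplikes. *)
Lemma kp_grouplike_span (U : {vspace kp}) :
    (forall a b : C, kp_qz a b \in I -> a = 0 /\ b = 0) ->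
    (forall i j, gl i j \in I -> gl i j \in U) -> (I <= U)%VS.
Proof.
move=> noQ IU; apply/subvP=> w wI; rewrite (kp_fourier w).
have [-> ->] := noQ _ _ (qz_mem_coef wI).
have [-> /eqP] := noQ _ _ (qx_mem_coef wI); rewrite oppr_eq0 => /eqP->.
have -> : kp_qz 0 0 = 0 :> kp by kp_ext; ring.
have -> : kp_qx 0 0 = 0 :> kp by kp_ext; ring.
have glU i j : ga i j w *: gl i j \in U.
  have [->|n0] := eqVneq (ga i j w) 0; first by rewrite scale0r mem0v.
  by rewrite memvZ // IU // (mem_glZ wI).
by rewrite !addr0 !memvD.
Qed.

End Closure.

(** In the absence of a z + b yz, the grouplikes in I form a subgroup of the
    Klein group {1, x, y, xy}. *)
Lemma kp_coideal_classify I : kp_coideal I -> I \in [:: 1%VS; fullv;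
  kp_I R true true; kp_I R true false; kp_I R false true; kp_J0 R; kp_J 'i; kp_J (- 'i)].
Proof.
move=> coI; rewrite !inE; case: (coI) => oneI IM _ _.
have [[a [b /andP[ab0 abI]]]|noQ'] :=
    pselect (exists a b, ((a != 0) || (b != 0)) && (kp_qz a b \in I)).
  have [xI|xI] := boolP (gl true false \in I).
    by rewrite (kp_full_x coI xI ab0 abI) eqxx ?orbT.
  have [yI|yI] := boolP (gl false true \in I).
    by rewrite (kp_full_y coI yI ab0 abI) eqxx ?orbT.
  have [e e2 ->] := kp_J_eq coI xI yI ab0 abI.
  have /eqP : (e - 'i) * (e + 'i) = 0 by have := @sqrCi C => h; ring: e2 h.
  by rewrite mulf_eq0 subr_eq0 addr_eq0 => /orP[] /eqP->; rewrite eqxx ?orbT.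
have noQ a b : kp_qz a b \in I -> a = 0 /\ b = 0.
  move=> abI; have [//|ab0] := pselect (a = 0 /\ b = 0); case: noQ'; exists a, b.
  rewrite abI andbT; apply: contra_notT ab0.
  by rewrite negb_or !negbK => /andP[/eqP-> /eqP->].
have glE (U : {vspace kp}) : (forall i j, gl i j \in I -> gl i j \in U) ->
    (U <= I)%VS -> I = U.
  move=> IU UI; apply/eqP; rewrite eqEsubv UI andbT.
  exact: kp_grouplike_span noQ IU.
have gM i j k l : gl i j \in I -> gl k l \in I -> gl (i (+) k) (j (+) l) \in I.
  by move=> /IM h /h; rewrite kp_glM.
have g00 : gl false false \in I by rewrite kp_gl00.
have spanI i j : gl i j \in I -> (kp_I R i j <= I)%VS.
  by move=> ijI; apply/span_subvP=> u; rewrite !inE => /orP[] /eqP->.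
have inI i j : (gl i j \in kp_I R i j) * (gl false false \in kp_I R i j).
  by split; rewrite memv_span // !inE eqxx ?orbT.
have [xI|xI] := boolP (gl true false \in I); last first.
  have [yI|yI] := boolP (gl false true \in I); last first.
    have [gI|gI] := boolP (gl true true \in I); last first.
      rewrite [I](_ : _ = 1%VS) ?eqxx //; apply: glE => [i j|]; last by rewrite -memvE.
      case: i j => [] []; rewrite ?(negPf xI) ?(negPf yI) ?(negPf gI) //.
      by rewrite kp_gl00 memv_line.
    rewrite [I](_ : _ = kp_I R true true) ?eqxx ?orbT //; apply: glE (spanI _ _ gI) => i j.
    by case: i j => [] []; rewrite ?(negPf xI) ?(negPf yI) ?inI.
  rewrite [I](_ : _ = kp_I R false true) ?eqxx ?orbT //; apply: glE (spanI _ _ yI) => i j.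
  case: i j => [] []; rewrite ?(negPf xI) ?inI // => /gM/(_ yI) /=.
  by rewrite (negPf xI).
have [yI|yI] := boolP (gl false true \in I).
  rewrite [I](_ : _ = kp_J0 R) ?eqxx ?orbT //; apply: glE => [i j _|].
    exact: kp_gl_J0.
  have gI := gM _ _ _ _ xI yI.
  by apply/span_subvP=> u; rewrite !inE => /or4P[] /eqP->.
rewrite [I](_ : _ = kp_I R true false) ?eqxx ?orbT //; apply: glE (spanI _ _ xI) => i j.
case: i j => [] []; rewrite ?(negPf yI) ?inI // => /gM/(_ xI) /=.
by rewrite (negPf yI).
Qed.
End Coideal.

(** * Dimensions and inclusions *)

Section Coideal.
Variable R : realType.
Local Notation C := (R[i]).
Local Notation kp := (kp_alg R).
Local Notation sgb := (sgb R).
Implicit Types (w u v : kp) (I : {vspace kp}).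
Local Notation ga := (kp_fcoef false).
Local Notation gb := (kp_fcoef true).
Local Notation gl := (kp_gl R).

(** Freeness of the generating families follows by induction, with the
    Fourier coefficient dual to the first generator for phi. *)
Lemma kp_free_cons (phi : {linear kp -> C^o}) v (X : seq kp) :
  (forall u, u \in X -> phi u = 0) -> phi v != 0 -> free X -> free (v :: X).
Proof.
move=> phi0 phiv fX; rewrite free_cons fX andbT.
by apply: contra phiv => /(kp_sep phi0) ->.
Qed.

Lemma oneC_neq0 : (1 : C^o) != 0. Proof. exact: oner_neq0. Qed.

Lemma kp_dim_I i j : i || j -> \dim (kp_I R i j) = 2%N.
Proof.
move=> ij; suff /eqP : free [:: gl false false; gl i j] by [].
apply: (@kp_free_cons (ga false false)) => [u||].
- by rewrite inE => /eqP->; rewrite /= kp_fcoefE; case: i j ij => [] [].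
- by rewrite /= kp_fcoefE oneC_neq0.
apply: (@kp_free_cons (ga i j)) => //; last exact: nil_free.
by rewrite /= kp_fcoefE !eqxx oneC_neq0.
Qed.

Lemma kp_dim_J0 : \dim (kp_J0 R) = 4%N.
Proof.
suff /eqP : free [:: gl false false; gl true false; gl false true; gl true true] by [].
apply: (@kp_free_cons (ga false false)) => [u||].
- by rewrite !inE => /or3P[] /eqP->; rewrite /= kp_fcoefE.
- by rewrite /= kp_fcoefE oneC_neq0.
apply: (@kp_free_cons (ga true false)) => [u||].
- by rewrite !inE => /orP[] /eqP->; rewrite /= kp_fcoefE.
- by rewrite /= kp_fcoefE oneC_neq0.
apply: (@kp_free_cons (ga false true)) => [u||].
- by rewrite !inE => /eqP->; rewrite /= kp_fcoefE.
- by rewrite /= kp_fcoefE oneC_neq0.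
apply: (@kp_free_cons (ga true true)) => //; last exact: nil_free.
by rewrite /= kp_fcoefE oneC_neq0.
Qed.

Lemma kp_dim_J (e : C) : \dim (kp_J e) = 4%N.
Proof.
suff /eqP : free [:: gl false false; gl true true; kp_qz 1 e; kp_qx 1 (- e)] by [].
apply: (@kp_free_cons (ga false false)) => [u||].
- by rewrite !inE => /or3P[] /eqP->; rewrite /= kp_fcoefE.
- by rewrite /= kp_fcoefE oneC_neq0.
apply: (@kp_free_cons (ga true true)) => [u||].
- by rewrite !inE => /orP[] /eqP->; rewrite /= kp_fcoefE.
- by rewrite /= kp_fcoefE oneC_neq0.
apply: (@kp_free_cons (gb false false)) => [u||].
- by rewrite !inE => /eqP->; rewrite /= kp_fcoefE.
- by rewrite /= kp_fcoefE oneC_neq0.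
apply: (@kp_free_cons (gb true false)) => //; last exact: nil_free.
by rewrite /= kp_fcoefE oneC_neq0.
Qed.

Lemma kp_gl_in_I i j k l : i || j -> (gl i j \in kp_I R k l) = (i == k) && (j == l).
Proof.
move=> ij; apply/idP/andP => [glI|[/eqP-> /eqP->]]; last first.
  by rewrite memv_span // !inE eqxx orbT.
apply/andP; apply/negPn/negP => nkl.
suff /eqP : ga i j (gl i j) = 0 by rewrite kp_fcoefE !eqxx (negPf oneC_neq0).
apply: (kp_sep (phi := ga i j) _ glI) => u; rewrite !inE => /orP[] /eqP->.
  by rewrite /= kp_fcoefE; case: i j ij {glI nkl} => [] [].
by rewrite /= kp_fcoefE /= (negPf nkl).
Qed.

Lemma kp_gl_in_J (e : C) i j : i (+) j -> (gl i j \in kp_J e) = false.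
Proof.
move=> ij; apply/negP => glJ.
suff /eqP : ga i j (gl i j) = 0 by rewrite kp_fcoefE !eqxx (negPf oneC_neq0).
apply: (kp_sep (phi := ga i j) _ glJ) => u; rewrite !inE => /or4P[] /eqP->;
by rewrite /= kp_fcoefE //; case: i j ij {glJ} => [] [].
Qed.

Lemma kp_gl11_in_J (e : C) : gl true true \in kp_J e.
Proof. by rewrite memv_span // !inE eqxx orbT. Qed.

Lemma kp_qz_in_I (b : C) k l : (kp_qz 1 b \in kp_I R k l) = false.
Proof.
apply/negP => qI.
suff /eqP : gb false false (kp_qz 1 b) = 0 by rewrite kp_fcoefE /= (negPf oneC_neq0).
by apply: (kp_sep (phi := gb false false) _ qI) => u; rewrite !inE => /orP[] /eqP->;
  rewrite /= kp_fcoefE.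
Qed.

Lemma kp_qz_in_J0 (b : C) : (kp_qz 1 b \in kp_J0 R) = false.
Proof.
apply/negP => qI.
suff /eqP : gb false false (kp_qz 1 b) = 0 by rewrite kp_fcoefE /= (negPf oneC_neq0).
by apply: (kp_sep (phi := gb false false) _ qI) => u; rewrite !inE => /or4P[] /eqP->;
  rewrite /= kp_fcoefE.
Qed.

Lemma kp_qz_in_J (e : C) : kp_qz 1 e \in kp_J e.
Proof. by rewrite memv_span // !inE eqxx ?orbT. Qed.

(** Otherwise the sum 2 z of z + e yz and z - e yz would be an element of
    the coideal subalgebra that is not isotropic. *)
Lemma kp_qzN_in_J (e : C) : e * e = -1 -> e^* = - e -> (kp_qz 1 (- e) \in kp_J e) = false.
Proof.
move=> e2 ec; apply/negP => qNJ.
have : kp_qz 1 e + kp_qz 1 (- e) \in kp_J e by rewrite memvD ?kp_qz_in_J.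
have -> : kp_qz 1 e + kp_qz 1 (- e) = kp_qz 2 0 :> kp by kp_ext; ring.
move/(mem_qz_isotropic (kp_J_coideal e2 ec)).
rewrite kp_gl_in_J // mulr0 addr0 => /(_ isT) /eqP.
by rewrite mulf_eq0 pnatr_eq0.
Qed.

Lemma sqr_i : 'i * 'i = -1 :> C. Proof. by rewrite -expr2 sqrCi. Qed.
Lemma sqr_Ni : - 'i * - 'i = -1 :> C. Proof. by rewrite mulrNN sqr_i. Qed.
Lemma conj_i : 'i^* = - 'i :> C. Proof. exact: conjCi. Qed.
Lemma conj_Ni : (- 'i)^* = - - 'i :> C. Proof. by rewrite rmorphN /= conj_i. Qed.

Definition kp_six : seq {vspace kp} := [:: kp_I R true true; kp_I R true false;
  kp_I R false true; kp_J0 R; kp_J 'i; kp_J (- 'i)].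

(** Five elements whose membership separates the six subspaces and refutes
    every inclusion that does not hold. *)
Definition kp_probe : seq kp :=
  [:: gl true false; gl false true; gl true true; kp_qz 1 'i; kp_qz 1 (- 'i)].

Definition kp_trace (U : {vspace kp}) : seq bool := [seq u \in U | u <- kp_probe].

Lemma kp_traceE : map kp_trace kp_six =
  [:: [:: false; false; true; false; false]; [:: true; false; false; false; false];
      [:: false; true; false; false; false]; [:: true; true; true; false; false];
      [:: false; false; true; true; false]; [:: false; false; true; false; true]].
Proof.
rewrite /= /kp_trace /= !kp_gl_in_I // !kp_gl_J0 !kp_gl11_in_J !kp_gl_in_J // !kp_qz_in_I.
rewrite !kp_qz_in_J0 !kp_qz_in_J (kp_qzN_in_J sqr_i conj_i).
by have := kp_qzN_in_J sqr_Ni conj_Ni; rewrite opprK => ->.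
Qed.

Lemma kp_six_uniq : uniq kp_six.
Proof. by apply: (@map_uniq _ _ kp_trace); rewrite kp_traceE. Qed.

Definition kp_inclusions : seq ({vspace kp} * {vspace kp}) :=
  [:: (kp_I R true true, kp_J0 R); (kp_I R true false, kp_J0 R);
      (kp_I R false true, kp_J0 R); (kp_I R true true, kp_J 'i);
      (kp_I R true true, kp_J (- 'i))].

Lemma kp_six_sub A B : A \in kp_six -> B \in kp_six -> A != B ->
  ((A <= B)%VS <-> (A, B) \in kp_inclusions).
Proof.
move=> As Bs AB; split=> [sAB|].
  have : all (fun p => p.1 ==> p.2) (zip (kp_trace A) (kp_trace B)).
    have impl u : (u \in A) ==> (u \in B) by apply/implyP; apply: (subvP sAB).
    by rewrite /= !impl.
  (* The truth table [kp_traceE] refutes every pair outside the list. *)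
  case/(nthP 0%VS): As AB {sAB} => i i6 <-; case/(nthP 0%VS): Bs => j j6 <-.
  rewrite -!(nth_map 0%VS [::] kp_trace) // kp_traceE /kp_inclusions.
  by case: i j i6 j6 => [|[|[|[|[|[|i]]]]]] [|[|[|[|[|[|j]]]]]] //= _ _;
    rewrite ?inE ?eqxx ?orbT.
have sI i j (U : {vspace kp}) : 1 \in U -> gl i j \in U -> (kp_I R i j <= U)%VS.
  move=> U1 Uij; apply/span_subvP=> u; rewrite !inE => /orP[] /eqP-> //.
  by rewrite kp_gl00.
have J0_1 : 1 \in kp_J0 R by rewrite -kp_gl00 kp_gl_J0.
have J_1 e : 1 \in kp_J e by rewrite -kp_gl00 memv_span // !inE eqxx.
rewrite !inE !xpair_eqE => /or4P[| | |/orP[]] /andP[/eqP-> /eqP->];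
by rewrite sI // ?kp_gl_J0 // kp_gl11_in_J.
Qed.
End Coideal.

(** * Transport to any Kac-Paljutkin algebra *)

Section KacPaljutkin.
Variable R : realType.
Local Notation C := (R[i]).

Definition kp_kac : kacAlgebra R :=
  KacAlgebra (@kp_starP R) (@kp_normP R) (@kp_HopfP R) (@kp_Delta_star R).

(** The elements x and z do not commute, and Delta(z) is not symmetric
    because the bicharacter J is not. *)
Lemma kp_kac_nontrivial : nontrivial_kac8 kp_kac.
Proof.
have neq1N1 : (1 : C) <> -1.
  by move/eqP; rewrite -addr_eq0 -mulr2n pnatr_eq0.
split.
- by rewrite dimvf /dim /= !card_prod card_bool.
- move/(_ (kp_gl R true false) (kp_qz 1 0)).
  (* The value of x z at ((1, 0), z) is -1, that of z x = yz is 1. *)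
  move/(congr1 (kp_ev (true, false, true))); rewrite !kp_ev_mul /kp_ev !ffunE /=.
  by rewrite !(mulr0, mul0r, mulr1, add0r, addr0) => /esym.
move/(_ (kp_qz 1 0)); rewrite -[kDelta _ _]/(kp_Delta (kp_qz 1 0)).
(* J(h, h') = 1 but J(h', h) = -1 for h = (1, 0) and h' = (0, 1). *)
move/(congr1 (tens_pair (kp_ev (true, false, true)) (kp_ev (false, true, true)))).
rewrite tens_pair_flip !kp_Delta_coef /kp_coef /= !ffunE /=.
by rewrite !(mul0r, addr0, mulr1) => /esym.
Qed.
End KacPaljutkin.

Section Transport.
Variable R : realType.

Definition kac_morphism (K L : kacAlgebra R) (f : {linear K -> L}) : Prop :=
  [/\ f 1 = 1, forall x y, f (x * y) = f x * f y,
      forall x, f (kstar x) = kstar (f x)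
    & forall x, kDelta L (f x) = tens_map f f (kDelta K x)].

Lemma coideal_img (K L : kacAlgebra R) (f : {linear K -> L}) (I : {vspace K}) :
  kac_morphism f -> coideal_subalgebra I -> coideal_subalgebra (linfun f @: I).
Proof.
case=> f1 fM fs fD [I1 IM Is ID].
have fI u : u \in I -> f u \in (linfun f @: I)%VS.
  by move=> uI; rewrite -(lfunE f) memv_img.
split; first by rewrite -f1 fI.
- move=> _ _ /memv_imgP[u uI ->] /memv_imgP[v vI ->].
  by rewrite !lfunE /= -fM fI ?IM.
- by move=> _ /memv_imgP[u uI ->]; rewrite lfunE /= -fs fI ?Is.
move=> _ /memv_imgP[u uI ->]; rewrite lfunE /= fD.
apply: (subvP (tensv_mono _ (subvf (linfun f @: fullv)))).
by apply: tens_map_tensv; apply: ID.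
Qed.

Lemma kac_isomorphicP (K L : kacAlgebra R) : kac_isomorphic K L ->
  exists (f : {linear K -> L}) (g : {linear L -> K}),
    [/\ cancel f g, cancel g f, kac_morphism f & kac_morphism g].
Proof.
case=> f [[g fK gK] [f1 fM] fs fD].
have f_inj : injective f := can_inj fK.
have gl : linear g.
  by move=> a u v; apply: f_inj; rewrite gK linearP !gK.
pose h : {linear L -> K} := HB.pack g (GRing.isLinear.Build _ _ _ _ g gl).
exists f, h; split=> //; split=> [|x y|x|x]; rewrite /h /=.
- by apply: f_inj; rewrite gK f1.
- by apply: f_inj; rewrite fM !gK.
- by apply: f_inj; rewrite fs !gK.
by rewrite -{2}[x]gK fD (tens_mapK (g := h) (g' := h) fK fK).
Qed.

Lemma kp_coidealP (I : {vspace kp_kac R}) :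
  coideal_subalgebra I <-> @kp_coideal R I.
Proof.
split=> -[I1 IM Is ID]; split=> //.
  by move=> u uI i; rewrite -slice_kp_Delta; apply: slice_tensv; apply: ID.
move=> u uI; rewrite [kDelta _ _]kp_Delta_slice memv_suml // => i _.
by rewrite memv_tensor ?memvf ?ID.
Qed.

Lemma kp_coideal_list (I : {vspace kp_alg R}) :
  kp_coideal I <-> I \in [:: 1%VS, fullv & kp_six R].
Proof.
split; first exact: kp_coideal_classify.
rewrite !inE => /orP[/eqP->|/orP[/eqP->|]].
- rewrite (_ : 1%VS = kp_I R false false); first exact: kp_I_coideal.
  by rewrite /kp_I kp_gl00 span_cons span_seq1 addvv.
- by split=> *; rewrite memvf.
do 3 (case/orP=> [/eqP->|]; first exact: kp_I_coideal).
case/or3P=> /eqP->; first exact: kp_J0_coideal.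
  exact: kp_J_coideal (sqr_i R) (conj_i R).
exact: kp_J_coideal (sqr_Ni R) (conj_Ni R).
Qed.
End Transport.

Theorem proposition3p3 (R : realType) (KP : kacAlgebra R)
    (hKP : is_Kac_Paljutkin KP) :
  exists I0 I1 I2 J0 J2 J4 : {vspace KP},
    let six := [:: I0; I1; I2; J0; J2; J4] in
    [/\ uniq six,
        forall I : {vspace KP}, I \in [:: I0; I1; I2] -> \dim I = 2%N,
        forall J : {vspace KP}, J \in [:: J0; J2; J4] -> \dim J = 4%N,
        forall I : {vspace KP},
          coideal_subalgebra I <-> I \in [:: 1%VS, fullv & six]
      & forall A B : {vspace KP}, A \in six -> B \in six -> A != B ->
          ((A <= B)%VS <->
           (A, B) \in [:: (I0, J0); (I1, J0); (I2, J0); (I0, J2); (I0, J4)])].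
Proof.
have [f [g [fK gK fP gP]]] := kac_isomorphicP (hKP.2 _ (kp_kac_nontrivial R)).
pose F (I : {vspace KP}) : {vspace kp_kac R} := (linfun f @: I)%VS.
pose G (I : {vspace kp_kac R}) : {vspace KP} := (linfun g @: I)%VS.
have gfE : (linfun g \o linfun f)%VF = \1%VF.
  by apply/lfunP=> x; rewrite comp_lfunE !lfunE /= fK.
have fgE : (linfun f \o linfun g)%VF = \1%VF.
  by apply/lfunP=> x; rewrite comp_lfunE !lfunE /= gK.
have FK : cancel F G by move=> I; rewrite /G /F -limg_comp gfE lim1g.
have GK : cancel G F by move=> I; rewrite /G /F -limg_comp fgE lim1g.
have G_inj := can_inj GK.
have subG A B : (G A <= G B)%VS = (A <= B)%VS.
  by apply/idP/idP=> sAB; [rewrite -[A]GK -[B]GK; apply: limgS | apply: limgS].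
have dimG A : \dim (G A) = \dim A.
  apply: limg_dim_eq; rewrite (_ : lker _ = 0%VS) ?capv0 //.
  apply/eqP/lker0P => u v; rewrite !lfunE; exact: (can_inj gK).
have G1 : G 1%VS = 1%VS.
  by rewrite /G limg_line lfunE /=; case: gP => ->.
have Gfull : G fullv = fullv.
  by apply/eqP; rewrite eqEsubv subvf -{1}[fullv]FK subG subvf.
have sixE : map G (kp_six R) =
  [:: G (kp_I R true true); G (kp_I R true false); G (kp_I R false true);
      G (kp_J0 R); G (kp_J 'i); G (kp_J (- 'i))] by [].
exists (G (kp_I R true true)), (G (kp_I R true false)), (G (kp_I R false true)).
exists (G (kp_J0 R)), (G (kp_J 'i)), (G (kp_J (- 'i))).
move=> six; rewrite {}/six -sixE; split.
- by rewrite map_inj_uniq // kp_six_uniq.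
- by move=> I; rewrite !inE => /or3P[] /eqP->; rewrite dimG kp_dim_I.
- move=> J; rewrite !inE => /or3P[] /eqP->; rewrite dimG ?kp_dim_J //.
  exact: kp_dim_J0.
- move=> I; have -> : [:: 1%VS, fullv & map G (kp_six R)] =
     map G [:: 1%VS, fullv & kp_six R] by rewrite /= G1 Gfull.
  rewrite -{2}[I]FK mem_map //; split=> [cI|].
    by apply/kp_coideal_list/kp_coidealP; apply: coideal_img.
  by move=> /kp_coideal_list/kp_coidealP FI; rewrite -[I]FK; apply: coideal_img.
move=> _ _ /mapP[A As ->] /mapP[B Bs ->]; rewrite (inj_eq G_inj) subG => AB.
rewrite (kp_six_sub As Bs AB).
pose GG (p : {vspace kp_alg R} * {vspace kp_alg R}) := (G p.1, G p.2).
rewrite -[X in _ <-> is_true (_ \in X)]/(map GG (kp_inclusions R)).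
rewrite -[X in _ <-> is_true (X \in _)]/(GG (A, B)) mem_map //.
by move=> [? ?] [? ?] [/G_inj-> /G_inj->].
Qed.
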